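(* Let $\lambda,\mu\in\mathbb{R}$ with $\mu>0$, $\lambda+2\mu>0$. Fix $\eta=(\eta_1,\eta_2)\in\mathbb{R}^2\setminus\{0\}$, put $\tau=|\eta|$, and for $r\in\mathbb{C}$ define $\zeta(r):=(i\eta_1,i\eta_2,r)^\top$ and $$\mathscr P_\eta(r):=\mu(r^2-\tau^2)I_3+(\lambda+\mu)\zeta(r)\zeta(r)^\top .$$ For $\mathbf a\in\mathbb{C}^3$, $$\mathcal L_{\lambda,\mu}\big(\mathbf a\,e^{i\eta\cdot x'+rx_3}\big)=\mathscr P_\eta(r)\mathbf a\,e^{i\eta\cdot x'+rx_3},$$ and $$\det\mathscr P_\eta(r)=\mu^2(\lambda+2\mu)(r^2-\tau^2)^3 .$$ Assume $\lambda+\mu\ne0$. Set $r_\pm=\pm\tau$ and $\zeta_\pm=\zeta(r_\pm)$. Each root $r_\pm$ has algebraic multiplicity three, and $$\ker\mathscr P_\eta(r_\pm)=\zeta_\pm^\perp,\qquad\dim\ker\mathscr P_\eta(r_\pm)=2 .$$ With $\mathfrak c_{\lambda,\mu}:=\frac{\lambda+3\mu}{\lambda+\mu}$, $\mathbf a_0:=\zeta_\pm$, $\mathbf a_1:=-\mathfrak c_{\lambda,\mu}e_3$, one has the length-two chain relations $$\mathscr P_\eta(r_\pm)\mathbf a_0=0,\qquad \mathscr P_\eta(r_\pm)\mathbf a_1+\mathscr P_\eta'(r_\pm)\mathbf a_0=0 .$$ Consequently, $$\mathbf w_{\eta,\pm}(x):=\big(x_3\zeta_\pm-\mathfrak c_{\lambda,\mu}e_3\big)e^{i\eta\cdot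 x'+r_\pm x_3}$$ belongs to $\mathcal H_{\lambda,\mu}$. The two partial multiplicities of $\mathscr P_\eta$ at $r_\pm$ are $2$ and $1$; in particular, no Jordan chain at this root has length greater than two. If $\lambda+\mu=0$, then $\mathscr P_\eta(r)=\mu(r^2-\tau^2)I_3$, and each root has algebraic and geometric multiplicity three and is semisimple.
   Context: $\mathcal L_{\lambda,\mu}\mathbf v=\mu\Delta\mathbf v+(\lambda+\mu)\nabla(\nabla\cdot\mathbf v)$ and $\mathcal H_{\lambda,\mu}:=\{\mathbf v\in H^1_{\mathrm{loc}}(\mathbb{R}^3;\mathbb{C}^3):\mathcal L_{\lambda,\mu}\mathbf v=0\text{ in }\mathbb{R}^3\}$. $x=(x',x_3)\in\mathbb{R}^2\times\mathbb{R}$, $e_3=(0,0,1)^\top$. The product $\mathbf a\cdot\mathbf b=\sum_ka_kb_k$ on $\mathbb{C}^3$ is complex bilinear, and $\zeta^\perp=\{\mathbf a\in\mathbb{C}^3:\zeta\cdot\mathbf a=0\}$. $\mathscr P_\eta'$ is the derivative in $r$. Standard terminology for a regular matrix polynomial $P$ (i.e. $\det P\not\equiv0$): the algebraic multiplicity of a root $r_0$ is its order as a zero of $\det P$; the geometric multiplicity is $\dim\ker P(r_0)$; a root is semisimple if all its Jordan chains have length one; a Jordan chain of length $m$ at $r_0$ is a sequence $\mathbf a_0\ne0,\mathbf a_1,\dots,\mathbf a_{m-1}$ with $\sum_{l=0}^{j}\frac1{l!}P^{(l)}(r_0)\mathbf a_{j-l}=0$ for $0\le j\le m-1$. The partial multiplicities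 at $r_0$ are the lengths of the chains in a canonical system of Jordan chains, equivalently the positive exponents of $(r-r_0)$ in the local Smith form of $P$ at $r_0$. *)

(* Defs.v *)
From HB Require Import structures.
From mathcomp Require Import all_boot all_order all_algebra.
From mathcomp Require Import all_classical all_reals all_analysis.
From mathcomp Require Import complex.

Set Implicit Arguments.
Unset Strict Implicit.
Unset Printing Implicit Defensive.

Import Order.TTheory GRing.Theory Num.Theory.
Import numFieldNormedType.Exports.

Local Open Scope classical_set_scope.
Local Open Scope ring_scope.
Local Open Scope complex_scope.

(** * Matrix polynomials *)

Section MatrixPolynomials.
Variables (K : numFieldType) (n : nat).
Implicit Types (P : 'M[{poly K}]_n) (z : K).

Definition mxeval P z : 'M[K]_n := map_mx (fun p => p.[z]) P.

Definition mxderivn (l : nat) P : 'M[{poly K}]_n := map_mx (fun p => p^`(l)) P.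

(* The kernel of the action on columns; [kermx] would be that on rows. *)
Definition colker (A : 'M[K]_n) : {vspace 'cV[K]_n} :=
  lker (linfun (mulmx A : 'cV[K]_n -> 'cV[K]_n)).

Definition alg_mult P z : nat := mup z (\det P).

Definition geom_mult P z : nat := \dim (colker (mxeval P z)).

(* The chain is nonempty because [head 0 [::] = 0]. *)
Definition jordan_chain P z (a : seq 'cV[K]_n) : Prop :=
  head 0 a != 0 /\
  forall j, (j < size a)%N ->
    \sum_(l < j.+1)
      ((l`!)%:R^-1 : K) *: (mxeval (mxderivn l P) z *m a`_(j - l)) = 0.

Definition semisimple_root P z : Prop :=
  forall a, jordan_chain P z a -> size a = 1%N.

(* The leading vectors form a basis of the kernel, and each chain is at least as
   long as any chain whose leading vector is outside the span of the leading
   vectors of the preceding ones; so the first chain has maximal length. *)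
Definition canonical_jordan_system P z (S : seq (seq 'cV[K]_n)) : Prop :=
  let leads := [seq head 0 s | s <- S] in
  [/\ forall s, s \in S -> jordan_chain P z s,
      basis_of (colker (mxeval P z)) leads &
      forall j c, (j < size S)%N -> jordan_chain P z c ->
        head 0 c \notin <<take j leads>>%VS ->
        (size c <= size (nth [::] S j))%N].

(* [ks] is in nonincreasing order. Canonical systems are not unique, so the
   lengths are prescribed for all of them. *)
Definition partial_multiplicities P z (ks : seq nat) : Prop :=
  (exists S, canonical_jordan_system P z S) /\
  (forall S, canonical_jordan_system P z S -> [seq size s | s <- S] = ks).

End MatrixPolynomials.

Definition col3 (T : nzRingType) (a b c : T) : 'cV[T]_3 :=
  \col_(k < 3) [:: a; b; c]`_k.

(* Bilinear, not Hermitian, also over the complex numbers. *)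
Definition bdot (T : nzRingType) (a b : 'cV[T]_3) : T :=
  \sum_(k < 3) a k 0 * b k 0.

(** * The Lamé operator and its solution space *)

Section Lame.
Variable R : realType.

Local Notation C := R[i].
(* x = (x', x_3) *)
Local Notation R3 := ((R * R) * R)%type.
Local Notation C3 := 'cV[C]_3.

Definition std_dir (k : 'I_3) : R3 :=
  ((((k : nat) == 0)%:R, ((k : nat) == 1)%:R), ((k : nat) == 2)%:R).

Definition re_fun (f : R3 -> C) : R3 -> R := fun x => complex.Re (f x).
Definition im_fun (f : R3 -> C) : R3 -> R := fun x => complex.Im (f x).

(* Meaningful for differentiable [f]; see [smooth]. *)
Definition pderiv (k : 'I_3) (f : R3 -> C) : R3 -> C :=
  fun x => 'D_(std_dir k) (re_fun f) x +i* 'D_(std_dir k) (im_fun f) x.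

(* All iterated partial derivatives exist and are continuous. *)
Definition smooth (f : R3 -> C) : Prop :=
  forall s : seq 'I_3, let g := foldr pderiv f s in
    [/\ continuous (re_fun g), continuous (im_fun g) &
        forall (k : 'I_3) x, derivable (re_fun g) x (std_dir k) /\
                             derivable (im_fun g) x (std_dir k)].

Definition test_function (f : R3 -> C) : Prop :=
  smooth f /\ compact (closure [set x | f x != 0]).

Definition component (v : R3 -> C3) (k : 'I_3) : R3 -> C := fun x => v x k 0.

Definition laplacian (f : R3 -> C) : R3 -> C :=
  fun x => \sum_(j < 3) pderiv j (pderiv j f) x.

Definition divergence (v : R3 -> C3) : R3 -> C :=
  fun x => \sum_(j < 3) pderiv j (component v j) x.

Definition gradient (f : R3 -> C) : R3 -> C3 :=
  fun x => \col_k pderiv k f x.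

Definition lame (lam mu : R) (v : R3 -> C3) : R3 -> C3 :=
  fun x => mu%:C *: (\col_k laplacian (component v k) x)
           + (lam + mu)%:C *: gradient (divergence v) x.

Local Notation mR := (measurableTypeR R).

Definition leb3 : {measure set (mR * mR * mR)%type -> \bar R} :=
  ((@lebesgue_measure R \x @lebesgue_measure R) \x @lebesgue_measure R)%E.

Definition cintegral (f : R3 -> C) : C :=
  Rintegral leb3 setT (re_fun f) +i* Rintegral leb3 setT (im_fun f).

Definition L2loc (f : R3 -> C) : Prop :=
  [/\ measurable_fun [set: mR * mR * mR] (re_fun f),
      measurable_fun [set: mR * mR * mR] (im_fun f) &
      forall A : set R3, compact A ->
        (\int[leb3]_(x in A) (re_fun f x ^+ 2 + im_fun f x ^+ 2)%:E < +oo)%E].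

Definition weak_pderiv (k : 'I_3) (f g : R3 -> C) : Prop :=
  forall phi, test_function phi ->
    cintegral (fun x => f x * pderiv k phi x)
    = - cintegral (fun x => g x * phi x).

Definition H1loc (v : R3 -> C3) : Prop :=
  forall j : 'I_3, L2loc (component v j) /\
    forall k : 'I_3, exists2 g, L2loc g & weak_pderiv k (component v j) g.

(* [lame lam mu] is its own transpose for the bilinear pairing, so this is
   [lame lam mu v = 0] in the sense of distributions. *)
Definition weak_lame_solution (lam mu : R) (v : R3 -> C3) : Prop :=
  forall phi : R3 -> C3, (forall k, test_function (component phi k)) ->
    cintegral (fun x => bdot (v x) (lame lam mu phi x)) = 0.

Definition lame_space (lam mu : R) : set (R3 -> C3) :=
  [set v | H1loc v /\ weak_lame_solution lam mu v].

(** * The symbol *)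

Definition cexp (z : C) : C :=
  (expR (complex.Re z) * cos (complex.Im z))
  +i* (expR (complex.Re z) * sin (complex.Im z)).

Section Symbol.
Variables (lam mu : R) (eta : R * R).

(* The Euclidean norm; the library norm on [R * R] is the sup norm. *)
Definition tau : R := Num.sqrt (eta.1 ^+ 2 + eta.2 ^+ 2).

Definition zeta (r : C) : C3 := col3 ('i%C * eta.1%:C) ('i%C * eta.2%:C) r.

Definition symbol (r : C) : 'M[C]_3 :=
  (mu%:C * (r ^+ 2 - tau%:C ^+ 2)) *: 1%:M
  + (lam + mu)%:C *: (zeta r *m (zeta r)^T).

(* [symbol] as a matrix polynomial in [r]. *)
Definition zetaX : 'cV[{poly C}]_3 :=
  col3 ('i%C * eta.1%:C)%:P ('i%C * eta.2%:C)%:P 'X.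

Definition symbolX : 'M[{poly C}]_3 :=
  ((mu%:C)%:P * ('X ^+ 2 - (tau%:C ^+ 2)%:P)) *: 1%:M
  + ((lam + mu)%:C)%:P *: (zetaX *m zetaX^T).

Lemma mxeval_symbolX (r : C) : mxeval symbolX r = symbol r.
Proof.
have zE k : (zetaX k 0).[r] = zeta r k 0.
  by rewrite !mxE; case: k => [[|[|[|k]]] hk] //=; rewrite ?hornerC ?hornerX.
have fE (T : nzRingType) (z : 'cV[T]_3) i j : (z *m z^T) i j = z i 0 * z j 0.
  by rewrite mxE big_ord1 [z^T _ _]mxE.
apply/matrixP=> i j; rewrite [LHS]mxE /symbolX /symbol.
transitivity ((mu%:C * (r ^+ 2 - tau%:C ^+ 2)) * (i == j)%:R
  + (lam + mu)%:C * (zeta r i 0 * zeta r j 0)).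
  have -> : forall A B : 'M[{poly C}]_3, (A + B) i j = A i j + B i j.
    by move=> A B; rewrite mxE.
  rewrite [(_ *: 1%:M) i j]mxE [(_ *: (_ *m _)) i j]mxE fE [1%:M i j]mxE.
  rewrite hornerD !hornerM !zE hornerD hornerN hornerXn !hornerC.
  by case: (i == j); rewrite ?hornerC ?horner0.
by rewrite [RHS]mxE [X in _ = X + _]mxE [X in _ = _ + X]mxE fE [1%:M i j]mxE.
Qed.

(* [exp (i eta . x' + r x_3)] *)
Definition plane_exp (r : C) (x : R3) : C :=
  cexp ('i%C * (eta.1 * x.1.1 + eta.2 * x.1.2)%:C + r * x.2%:C).

Definition cconst : R := (lam + 3 * mu) / (lam + mu).

Definition e3 : C3 := col3 0 0 1.

Definition weta (r : C) (x : R3) : C3 :=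
  plane_exp r x *: (x.2%:C *: zeta r - cconst%:C *: e3).

End Symbol.
End Lame.

(* Main.v *)
(* On the symbol [m (r^2 - tau^2) I + b z z^T] at a root [r = +- tau] the vector
   [z] is isotropic and the symbol reduces to [b z z^T]. Hence the kernel is the
   orthogonal of [z], the second chain relation forces the leading vector of a
   chain of length two to be a multiple of [z], and pairing the third relation
   with [z] would force [m (m + b) = 0].

   The functions [(a x_3 + b) exp (i eta . x' + r x_3)] are stable under partial
   derivatives: [d_k] sends [(a, b)] to [(a zeta_k, b zeta_k + a delta_(k 3))].
   So they are smooth, and applying the Lame operator to them amounts to
   applying the symbol and its derivative, which vanishes on a Jordan chain.
   Smooth solutions are weak solutions by integration by parts, which reduces
   through Fubini to the fundamental theorem of calculus along each axis. *)

Require Import Defs.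
From HB Require Import structures.
From mathcomp Require Import all_boot all_order all_algebra.
From mathcomp Require Import all_classical all_reals all_analysis.
From mathcomp Require Import complex ring.

Set Implicit Arguments.
Unset Strict Implicit.
Unset Printing Implicit Defensive.

Import Order.TTheory GRing.Theory Num.Theory.
Import numFieldNormedType.Exports.

Local Open Scope classical_set_scope.
Local Open Scope ring_scope.
Local Open Scope complex_scope.

(** * Three-dimensional vectors and matrices *)

Lemma sum3 (V : nmodType) (F : 'I_3 -> V) :
  \sum_k F k = F 0 + F 1 + F (inord 2).
Proof.
rewrite !big_ord_recl big_ord0 addr0 addrA.
by congr (F _ + F _ + F _); apply: val_inj; rewrite //= inordK.
Qed.

Lemma ord3P (Q : 'I_3 -> Prop) : Q 0 -> Q 1 -> Q (inord 2) -> forall k, Q k.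
Proof.
move=> Q0 Q1 Q2 k; have [|[|]] : k = 0 \/ k = 1 \/ k = inord 2;
  try by move=> ->.
case: k => [[|[|[|k]]] hk] //; [left|right; left|right; right];
  apply: val_inj => //=.
by rewrite inordK.
Qed.

Section Col3.
Variable T : comNzRingType.
Implicit Types (a b z : 'cV[T]_3).

Lemma col3E0 (x y z : T) : col3 x y z 0 0 = x. Proof. by rewrite mxE. Qed.
Lemma col3E1 (x y z : T) : col3 x y z 1 0 = y. Proof. by rewrite mxE. Qed.
Lemma col3E2 (x y z : T) : col3 x y z (inord 2) 0 = z.
Proof. by rewrite mxE inordK. Qed.
Definition col3E := (col3E0, col3E1, col3E2).

Lemma col3_eta a : a = col3 (a 0 0) (a 1 0) (a (inord 2) 0).
Proof. by apply/colP; apply: ord3P; rewrite col3E. Qed.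

Lemma bdot_col3 (x y z x' y' z' : T) :
  bdot (col3 x y z) (col3 x' y' z') = x * x' + y * y' + z * z'.
Proof. by rewrite /bdot sum3 !col3E. Qed.

Lemma mulmx_rank1 z a b : (z *m a^T) *m b = bdot a b *: z.
Proof.
rewrite -mulmxA; apply/colP => k; rewrite !mxE big_ord1 mulrC; congr (_ * _).
by rewrite mxE; apply: eq_bigr => i _; rewrite mxE.
Qed.

Lemma bdotDr z a b : bdot z (a + b) = bdot z a + bdot z b.
Proof. by rewrite /bdot -big_split; apply: eq_bigr => k _;
  rewrite mxE mulrDr. Qed.

Lemma bdot_e3 a : bdot (col3 0 0 1) a = a (inord 2) 0.
Proof. by rewrite [a]col3_eta bdot_col3 !col3E; ring. Qed.

Lemma bdotr0 z : bdot z 0 = 0.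
Proof. by rewrite /bdot big1 // => k _; rewrite mxE mulr0. Qed.

Lemma bdotZr z (c : T) a : bdot z (c *: a) = c * bdot z a.
Proof. by rewrite /bdot mulr_sumr; apply: eq_bigr => k _;
  rewrite mxE mulrCA. Qed.

Lemma scalar_add_rank1E (s b : T) z i j :
  (s *: 1%:M + b *: (z *m z^T)) i j = s * (i == j)%:R + b * (z i 0 * z j 0).
Proof. by rewrite !mxE big_ord1 mxE. Qed.

(** Indexing through [nat] lets the ordinals produced by nested cofactor expansions reduce to
    numerals, so that [ring] can recognise equal entries. *)
Lemma det_mx33 (A : 'M[T]_3) (f := fun i j : nat => A (inord i) (inord j)) :
  \det A = f 0 0 * (f 1 1 * f 2 2 - f 1 2 * f 2 1)
         - f 0 1 * (f 1 0 * f 2 2 - f 1 2 * f 2 0)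
         + f 0 2 * (f 1 0 * f 2 1 - f 1 1 * f 2 0).
Proof.
have fE i j : A i j = f i j by rewrite /f !inord_val.
rewrite (expand_det_row _ ord0) !big_ord_recl big_ord0 /cofactor.
rewrite !(expand_det_row _ ord0) !big_ord_recl !big_ord0 /cofactor !det_mx11.
by rewrite !mxE !fE /= /bump /=; ring.
Qed.

(** The matrix determinant lemma in division-free form: it holds over any commutative ring, hence
    both for the polynomial matrix and for its values. *)
Lemma det_scalar_add_rank1 (s b : T) z :
  \det (s *: 1%:M + b *: (z *m z^T)) = s ^+ 3 + s ^+ 2 * b * bdot z z.
Proof.
have i0 : inord 0 = 0 :> 'I_3 by apply: val_inj; rewrite /= inordK.
have i1 : inord 1 = 1 :> 'I_3 by apply: val_inj; rewrite /= inordK.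
rewrite det_mx33 !scalar_add_rank1E i0 i1 [z]col3_eta !col3E bdot_col3
  -!val_eqE /= !inordK //=.
ring.
Qed.
End Col3.

(** * Jordan chains of the symbol *)

(** The common shape of the entries of the pencil: [d] is the Kronecker delta and the two affine
    factors are coordinates of [z]. Two derivatives suffice, since the chain relations are used up
    to order two. *)
Lemma pencil_entry_derivn (K : numFieldType) (m b t2 d u v x y r : K)
  (f := m%:P * ('X ^+ 2 - t2%:P) * d%:P
        + b%:P * ((u%:P + x%:P * 'X) * (v%:P + y%:P * 'X))) :
  [/\ f.[r] = m * (r ^+ 2 - t2) * d + b * ((u + x * r) * (v + y * r)),
      (f^`(1)).[r] = 2 * m * r * d + b * (x * (v + y * r) + y * (u + x * r)) &
      (f^`(2)).[r] = 2 * (m * d + b * (x * y))].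
Proof.
split.
- by rewrite !(hornerD, hornerM, hornerN, hornerXn, hornerX, hornerC).
- rewrite derivn1 /f !(derivD, derivM, derivN, derivXn, derivX, derivC).
  rewrite !(hornerD, hornerM, hornerN, hornerXn, hornerX, hornerC, hornerMn).
  ring.
- rewrite derivnS derivn1 /f.
  rewrite  !(derivD, derivM, derivN, derivXn, derivX, derivC, derivMn, deriv0).
  rewrite !(hornerD, hornerM, hornerN, hornerXn, hornerX, hornerC, hornerMn,
    horner0).
  ring.
Qed.

Section MatrixPolynomial.
Variables (K : numFieldType) (n : nat).

Lemma mxderivn0 (P : 'M[{poly K}]_n) : mxderivn 0 P = P.
Proof. by apply/matrixP => i j; rewrite mxE derivn0. Qed.

Lemma colkerP (A : 'M[K]_n) v : reflect (A *m v = 0) (v \in colker A).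
Proof. by rewrite memv_ker lfunE; exact: eqP. Qed.

Lemma jordan_chain_gt0 (P : 'M[{poly K}]_n) r c :
  jordan_chain P r c -> (0 < size c)%N.
Proof. by case; case: c => //=; rewrite eqxx. Qed.
End MatrixPolynomial.

(* The symbol of the Lame operator is the case [m = mu], [b = lam + mu],
   [t2 = tau ^ 2] and [(p, q) = i eta], whence [p ^ 2 + q ^ 2 = - t2]. *)
Definition pencil (K : numFieldType) (m b t2 p q : K) : 'M[{poly K}]_3 :=
  let zX : 'cV[{poly K}]_3 := col3 p%:P q%:P 'X in
  (m%:P * ('X ^+ 2 - t2%:P)) *: 1%:M + b%:P *: (zX *m zX^T).

(** * Action of the pencil and its derivatives on vectors *)

Section Pencil.
Variables (K : numFieldType) (m b t2 p q : K).

Let zX : 'cV[{poly K}]_3 := col3 p%:P q%:P 'X.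
Let z (r : K) : 'cV[K]_3 := col3 p q r.
Let e : 'cV[K]_3 := col3 0 0 1.
Let PX : 'M[{poly K}]_3 := pencil m b t2 p q.

(** Each coordinate of [zX] is affine in ['X], with the coordinate of [e] as slope; this is the
    shape treated by [pencil_entry_derivn]. *)
Let PXE i j : PX i j = m%:P * ('X ^+ 2 - t2%:P) * ((i == j)%:R)%:P
  + b%:P * (((z 0 i 0)%:P + (e i 0)%:P * 'X) *
      ((z 0 j 0)%:P + (e j 0)%:P * 'X)).
Proof.
have zE k : zX k 0 = (z 0 k 0)%:P + (e k 0)%:P * 'X.
  by move: k; apply: ord3P; rewrite !col3E ?polyC0 ?mul0r ?addr0 ?polyC1 ?mul1r
    ?add0r.
by rewrite scalar_add_rank1E -!zE; case: eqP; rewrite ?polyC1 ?polyC0.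
Qed.

Let zE r k : z r k 0 = z 0 k 0 + e k 0 * r.
Proof.
by move: k; apply: ord3P; rewrite !col3E ?mul0r ?addr0 ?add0r ?mul1r.
Qed.

Let mxevalE l r i j : mxeval (mxderivn l PX) r i j = ((PX i j)^`(l)).[r].
Proof. by rewrite [LHS]mxE [X in X.[r]]mxE. Qed.

Lemma pencil_at r (a : 'cV[K]_3) : r ^+ 2 = t2 ->
  mxeval PX r *m a = (b * bdot (z r) a) *: z r.
Proof.
move=> rt.
suff -> : mxeval PX r = b *: (z r *m (z r)^T).
  by rewrite -scalemxAl mulmx_rank1 scalerA.
apply/matrixP => i j; rewrite -[PX in LHS]mxderivn0 mxevalE PXE derivn0
  [RHS]mxE.
rewrite [in RHS]mxE big_ord1 [(_^T) _ _]mxE !(zE r).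
have [-> _ _] := pencil_entry_derivn m b t2 ((i == j)%:R) (z 0 i 0) (z 0 j 0)
    (e i 0) (e j 0) r.
by rewrite rt subrr mulr0 mul0r add0r mulrA.
Qed.

(** Product rule with [z' = e]: the rank-one part contributes [b (z e^T + e z^T)]. *)
Lemma pencil_deriv1_at r (a : 'cV[K]_3) :
  mxeval (mxderivn 1 PX) r *m a =
  (2 * m * r) *: a + b *: (bdot e a *: z r + bdot (z r) a *: e).
Proof.
suff -> : mxeval (mxderivn 1 PX) r =
    (2 * m * r) *: 1%:M + b *: (z r *m e^T + e *m (z r)^T).
  by rewrite mulmxDl -!scalemxAl mul1mx mulmxDl !mulmx_rank1.
apply/matrixP => i j; rewrite mxevalE PXE.
have [_ -> _] := pencil_entry_derivn m b t2 ((i == j)%:R) (z 0 i 0) (z 0 j 0)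
    (e i 0) (e j 0) r.
rewrite [RHS]mxE [X in _ = X + _]mxE [X in _ = _ + X]mxE [1%:M i j]mxE;
  congr (_ + _ * _).
rewrite [RHS]mxE ![in RHS]mxE !big_ord1 ![(_^T) _ _]mxE !(zE r).
ring.
Qed.

(** As [z'' = 0], the second derivative is the constant matrix [2 (m I + b e e^T)]. *)
Lemma pencil_deriv2_at r (a : 'cV[K]_3) :
  mxeval (mxderivn 2 PX) r *m a = 2 *: (m *: a + (b * bdot e a) *: e).
Proof.
suff -> : mxeval (mxderivn 2 PX) r = 2 *: (m *: 1%:M + b *: (e *m e^T)).
  by rewrite -scalemxAl mulmxDl -!scalemxAl mul1mx !mulmx_rank1 !scalerA.
apply/matrixP => i j; rewrite mxevalE PXE.
have [_ _ ->] := pencil_entry_derivn m b t2 ((i == j)%:R) (z 0 i 0) (z 0 j 0)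
    (e i 0) (e j 0) r.
rewrite [RHS]mxE; congr (_ * _).
rewrite [RHS]mxE [X in _ = X + _]mxE [X in _ = _ + X]mxE [1%:M i j]mxE;
  congr (_ + _ * _).
by rewrite [RHS]mxE big_ord1 [(_^T) _ _]mxE.
Qed.
End Pencil.

(** * Kernel, Jordan chains and partial multiplicities at a root, for nonzero [b] *)

Section Chains.
Variables (K : numFieldType) (m b t2 p q r : K).
Hypotheses (rt : r ^+ 2 = t2) (pqt : p ^+ 2 + q ^+ 2 = - t2).
Hypotheses (r0 : r != 0) (m0 : m != 0) (b0 : b != 0) (mb0 : m + b != 0).

Let z : 'cV[K]_3 := col3 p q r.
(** A horizontal vector orthogonal to [z], completing [z] to a basis of the kernel. *)
Let g : 'cV[K]_3 := col3 (- q) p 0.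
Let e : 'cV[K]_3 := col3 0 0 1.
Let PX : 'M[{poly K}]_3 := pencil m b t2 p q.

Let zz : bdot z z = 0.
Proof. rewrite bdot_col3 -!expr2 pqt rt; ring. Qed.
Let ze : bdot z e = r.
Proof. rewrite bdot_col3; ring. Qed.
Let ez : bdot e z = r.
Proof. rewrite bdot_col3; ring. Qed.
Let zg : bdot z g = 0.
Proof. rewrite bdot_col3; ring. Qed.
Let z0 : z != 0.
Proof.
by apply/negP => /eqP/(congr1 (bdot e))/eqP; rewrite ez bdotr0 (negPf r0).
Qed.

Lemma mem_colker_pencil a : (a \in colker (mxeval PX r)) = (bdot z a == 0).
Proof.
have E : mxeval PX r *m a = (b * bdot z a) *: z by exact: pencil_at.
by apply/colkerP/eqP; rewrite E; [move=> /eqP | move=> ->;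
  rewrite mulr0 scale0r];
  rewrite // scaler_eq0 (negPf z0) orbF mulf_eq0 (negPf b0) => /eqP.
Qed.

Lemma basis_colker_pencil : basis_of (colker (mxeval PX r)) [:: z; g].
Proof.
have t0 : p ^+ 2 + q ^+ 2 != 0 by rewrite pqt -rt oppr_eq0 sqrf_eq0.
have Sub : (<<[:: z; g]>> <= colker (mxeval PX r))%VS.
  apply/span_subvP => v; rewrite !inE => /orP[] /eqP ->;
    rewrite mem_colker_pencil.
    by rewrite zz.
  by rewrite zg.
rewrite /basis_of; apply/andP; split.
- rewrite eqEsubv Sub; apply/subvP => v; rewrite mem_colker_pencil => /eqP.
  rewrite [v]col3_eta bdot_col3; set x := v 0 0; set y := v 1 0;
    set w := v _ 0 => E.
  rewrite span_cons span_seq1; apply/memv_addP; exists ((w / r) *: z).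
    by rewrite memvZ ?memv_line.
  exists (((p * y - q * x) / (p ^+ 2 + q ^+ 2)) *: g);
    first by rewrite memvZ ?memv_line.
  (* Orthogonality to [z] reads [p x + q y = - r w], and [p^2 + q^2 = - r^2]; with this common
     denominator the horizontal coordinates become field identities. *)
  have -> : w / r = (p * x + q * y) / (p ^+ 2 + q ^+ 2).
    rewrite pqt -rt; have -> : p * x + q * y = - (r * w) by apply/eqP;
      rewrite -addr_eq0 E.
    by field.
  apply/colP; apply: ord3P; rewrite [RHS]mxE [(_ *: z) _ _]mxE
    [(_ *: g) _ _]mxE !col3E; [by field | by field | ].
  by rewrite mulr0 addr0 pqt -rt; have -> : p * x + q * y = - (r * w);
    [apply/eqP; rewrite -addr_eq0 E | field].
(* The third coordinate separates [z] from the line of [g], and [g] is nonzero because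
   [g . g = p^2 + q^2] is. *)
- rewrite free_cons seq1_free span_seq1; apply/andP; split.
    apply/negP => /vlineP[k /(congr1 (bdot e))];
      rewrite ez bdotZr bdot_col3 => /eqP.
    by rewrite !(mul0r, mulr0, addr0) (negPf r0).
  apply/negP => /eqP /(congr1 (bdot g)); rewrite bdotr0 bdot_col3 => /eqP.
  by rewrite mulr0 addr0 mulrNN addrC -!expr2 (negPf t0).
Qed.

Lemma dim_colker_pencil : \dim (colker (mxeval PX r)) = 2%N.
Proof.
have := basis_colker_pencil; rewrite basisEfree => /and3P[_ _].
have /andP[/eqP <- /eqP] := basis_colker_pencil.
by move=> ->.
Qed.

Let chain_eq c j : jordan_chain PX r c -> (j < size c)%N ->
  \sum_(l < j.+1)
    ((l`!)%:R^-1 : K) *: (mxeval (mxderivn l PX) r *m c`_(j - l)) = 0.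
Proof. by case=> _; exact. Qed.

Lemma pencil_chain_head c : jordan_chain PX r c -> bdot z c`_0 = 0.
Proof.
move=> cP; have := chain_eq cP (jordan_chain_gt0 cP).
rewrite big_ord1 invr1 scale1r /= subn0 mxderivn0.
rewrite (pencil_at _ _ _ _ _ rt) => /eqP.
by rewrite scaler_eq0 (negPf z0) orbF mulf_eq0 (negPf b0) => /eqP.
Qed.

(** Since [z . c_0 = 0], the first-order relation reads [2 m r c_0 = - (b z . c_1 + b e . c_0) z],
    so [c_0] is a multiple of [z]. The scalar equation is what remains as coefficient of [z]; it
    serves to exclude chains of length three. *)
Lemma pencil_chain2 c : jordan_chain PX r c -> (1 < size c)%N ->
  exists s, c`_0 = s *: z /\ b * bdot z c`_1 + (2 * m + b) * s * r = 0.
Proof.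
move=> cP c_gt1; have zc0 := pencil_chain_head cP.
have := chain_eq cP c_gt1; rewrite !big_ord_recl big_ord0 /=
  !invr1 !scale1r addr0.
rewrite mxderivn0 (pencil_at _ _ _ _ _ rt) pencil_deriv1_at zc0 scale0r addr0
  scalerA => E.
set s := - (b * bdot z c`_1 + b * bdot e c`_0) / (2 * m * r).
have mr0 : 2 * m * r != 0 by rewrite !mulf_neq0 // pnatr_eq0.
have c0s : c`_0 = s *: z.
  apply: (scalerI mr0); rewrite scalerA /s [X in X *: z]mulrC mulfVK // scaleNr
    scalerDl.
  by apply/eqP; rewrite -addr_eq0 addrCA E.
exists s; split=> //; move: E; rewrite c0s bdotZr ez scalerA -!scalerDl => /eqP.
by rewrite scaler_eq0 (negPf z0) orbF => /eqP <-; ring.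
Qed.

Lemma pencil_chain_size c : jordan_chain PX r c -> (size c <= 2)%N.
Proof.
move=> cP; rewrite leqNgt; apply/negP => c_gt2.
have [s [c0s E1]] := pencil_chain2 cP (ltnW c_gt2).
have := chain_eq cP c_gt2; rewrite !big_ord_recl big_ord0 /=
  !invr1 !scale1r addr0.
rewrite mxderivn0 (pencil_at _ _ _ _ _ rt) pencil_deriv1_at pencil_deriv2_at
  c0s.
(* [z] is isotropic: pairing with it removes the unknown next vector. *)
move/(congr1 (bdot z)); rewrite bdotr0 !(bdotDr, bdotZr) zz ze ez => E2.
(* The two scalar relations form a linear system in [w] and [s r] whose determinant is
   [b^2 - (2 m + b)^2 = - 4 m (m + b)]. Hence [s = 0], against the nonzero leading vector. *)
have : s * r * (4 * m * (m + b)) = 0.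
  move: E1 E2; set w := bdot z c`_1 => E1 E2.
  have E2' : (2 * m + b) * w + b * s * r = 0.
    by apply: (mulfI r0); rewrite mulr0 -[RHS]E2 /bump (_ : _`! = 2%N) //;
      field.
  have -> : s * r * (4 * m * (m + b)) =
      (2 * m + b) * (b * w + (2 * m + b) * s * r) -
      b * ((2 * m + b) * w + b * s * r) by ring.
  by rewrite E1 E2' !mulr0 subr0.
have [c0 _] := cP.
move/eqP; rewrite !mulf_eq0 (negPf r0) (negPf m0) (negPf mb0) pnatr_eq0 !orbF
  => /eqP s0.
by move: c0; rewrite -nth0 c0s s0 scale0r eqxx.
Qed.

(** Both terms are multiples of [z]: the derivative gives [(2 m + b) r z] and the pencil sends [e]
    to [b r z], which determines the factor [(2 m + b) / b]. *)
Lemma pencil_chain_rel :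
  mxeval PX r *m (- (((2 * m + b) / b) *: e)) +
    mxeval (mxderivn 1 PX) r *m z = 0.
Proof.
rewrite (pencil_at _ _ _ _ _ rt) pencil_deriv1_at -scaleNr bdotZr -!/e ze ez zz.
rewrite scale0r addr0.
rewrite scalerA -!scalerDl; apply/eqP; rewrite scaler_eq0; apply/orP; left;
  apply/eqP.
by rewrite -[_ *: r]/(_ * r); field.
Qed.

(** The first chain has the maximal length two. The second cannot be bettered, because chains of
    length at least two start on the line of [z]. *)
Lemma pencil_canonical_system :
  canonical_jordan_system PX r [:: [:: z; - (((2 * m + b) / b) *: e)]; [:: g]].
Proof.
have kz a : bdot z a = 0 -> mxeval (mxderivn 0 PX) r *m a = 0.
  by move=> za; rewrite mxderivn0 (pencil_at _ _ _ _ _ rt) za mulr0 scale0r.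
split.
- move=> s; rewrite !inE => /orP[] /eqP ->; split=> //=.
  + move=> [|[|//]] _.
      by rewrite big_ord1 kz ?scaler0.
    rewrite !big_ord_recl big_ord0 /= !invr1 !scale1r addr0 mxderivn0.
    exact: pencil_chain_rel.
  + by move: basis_colker_pencil => /andP[_];
      rewrite free_cons seq1_free => /andP[_].
  + by move=> [|//] _; rewrite big_ord1 kz ?scaler0.
- exact: basis_colker_pencil.
- move=> [|[|//]] c _ cP hc; first exact: pencil_chain_size.
  rewrite leqNgt; apply/negP => c_gt1; have [s [c0s _]] :=
    pencil_chain2 cP c_gt1.
  by move/negP: hc; apply; rewrite -nth0 c0s span_seq1 memvZ ?memv_line.
Qed.

(** Any canonical system has two chains, the dimension of the kernel. The first is at least as long
    as the explicit chain starting at [z], hence of length two; were the second longer than one,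
    both leading vectors would be multiples of [z] and not free. *)
Lemma pencil_partial_multiplicities : partial_multiplicities PX r [:: 2%N; 1%N].
Proof.
split; first by exists [:: [:: z; - (((2 * m + b) / b) *: e)]; [:: g]];
  exact: pencil_canonical_system.
move=> S [Sch Sb Smax].
have sizeS : size S = 2%N.
  transitivity (\dim (colker (mxeval PX r))); last exact: dim_colker_pencil.
  by move: Sb => /andP[/eqP <- /eqP ->]; rewrite size_map.
case: S sizeS Sch Sb Smax => [|s0 [|s1 [|//]]] // _ Sch Sb Smax /=.
have s0P := Sch s0 (mem_head _ _); have s1P :
    jordan_chain PX r s1 by apply: Sch; rewrite !inE eqxx orbT.
have [Z _ _] := pencil_canonical_system.
have {}Z := Z _ (mem_head _ _).
have s0_gt1 : (1 < size s0)%N.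
  by apply: (Smax 0%N _ _ Z) => //=; rewrite span_nil memv0.
have -> : size s0 = 2%N by apply/eqP; rewrite eqn_leq s0_gt1 pencil_chain_size.
have s1_gt0 := jordan_chain_gt0 s1P.
suff : (size s1 <= 1)%N by case: (size s1) s1_gt0 => [|[|]].
rewrite leqNgt; apply/negP => s1_gt1.
have [k [E0 _]] := pencil_chain2 s0P s0_gt1;
    have [l [E1 _]] := pencil_chain2 s1P s1_gt1.
move: Sb => /andP[_]; rewrite /= free_cons => /andP[/negP + _]; apply.
rewrite span_seq1 -!nth0 E0 E1.
have l0 : l != 0 by case: s1P => + _; rewrite -nth0 E1;
    apply: contraNneq => ->; rewrite scale0r.
by rewrite -[k](mulfVK l0) -scalerA memvZ ?memv_line.
Qed.
End Chains.

(** * Determinant of the pencil, and semisimplicity when [b = 0] *)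

Section Multiplicity.
Variables (K : numFieldType) (m b t2 p q : K).
Hypotheses (pqt : p ^+ 2 + q ^+ 2 = - t2).
Let PX : 'M[{poly K}]_3 := pencil m b t2 p q.

Lemma det_pencil : \det PX = (m ^+ 2 * (m + b))%:P * ('X ^+ 2 - t2%:P) ^+ 3.
Proof.
rewrite det_scalar_add_rank1 bdot_col3.
have -> : p%:P * p%:P + q%:P * q%:P + 'X * 'X = 'X ^+ 2 - t2%:P :> {poly K}.
  by rewrite -!polyCM -polyCD -!expr2 pqt polyCN addrC.
rewrite !(polyCM, polyCD); ring.
Qed.

Lemma alg_mult_pencil r : r ^+ 2 = t2 -> r != 0 -> m != 0 -> m + b != 0 ->
  alg_mult PX r = 3%N.
Proof.
move=> rt r0 m0 mb0; rewrite /alg_mult det_pencil -rt.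
(* Only the factor ['X - r] vanishes at [r]; the other one takes the nonzero value [2 r] there. *)
have -> : 'X ^+ 2 - (r ^+ 2)%:P = ('X - r%:P) * ('X - (- r)%:P) :> {poly K}.
  by rewrite polyCN opprK polyCM; ring.
rewrite exprMn mupMr; last by rewrite rootC mulf_neq0 // expf_neq0.
rewrite mupMl ?mup_XsubCX ?eqxx // /root horner_exp hornerXsubC opprK -mulr2n.
by rewrite expf_neq0 // mulrn_eq0.
Qed.

Lemma geom_mult_scalar_pencil r : r ^+ 2 = t2 -> b = 0 -> geom_mult PX r = 3%N.
Proof.
move=> rt b0; rewrite /geom_mult.
have -> : colker (mxeval PX r) = fullv.
  apply/vspaceP => v; rewrite memvf; apply/colkerP.
  by rewrite (pencil_at _ _ _ _ _ rt) b0 mul0r scale0r.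
by rewrite dimvf.
Qed.

(** For [b = 0] the first-order chain relation reduces to [2 m r c_0 = 0], so no chain reaches
    length two. *)
Lemma semisimple_scalar_pencil r : r ^+ 2 = t2 -> r != 0 -> m != 0 -> b = 0 ->
  semisimple_root PX r.
Proof.
move=> rt r0 m0 b0 c cc; have [c0 cP] := cc.
apply/eqP; rewrite eqn_leq (jordan_chain_gt0 cc) andbT leqNgt;
  apply/negP => /cP.
rewrite !big_ord_recl big_ord0 /=
  !invr1 !scale1r addr0.
rewrite mxderivn0 (pencil_at _ _ _ _ _ rt) pencil_deriv1_at b0 mul0r !scale0r
  addr0 add0r => /eqP.
by rewrite scaler_eq0 !mulf_eq0 pnatr_eq0 (negPf r0) (negPf m0) /= nth0
  (negPf c0).
Qed.
End Multiplicity.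

(** * The Lame symbol as an instance of the pencil *)

Section SymbolPencil.
Variables (R : realType) (lam mu : R) (eta : R * R).
Local Notation t := (tau eta).

Lemma tau_sqr : t ^+ 2 = eta.1 ^+ 2 + eta.2 ^+ 2.
Proof. by rewrite sqr_sqrtr // addr_ge0 // sqr_ge0. Qed.

Lemma tau_neq0 : eta <> (0, 0) -> t != 0.
Proof.
move=> eta0; apply/eqP => /(congr1 (fun x => x ^+ 2)) /eqP.
rewrite tau_sqr expr0n paddr_eq0 ?sqr_ge0 // !sqrf_eq0 =>
  /andP[/eqP e1 /eqP e2].
by apply: eta0; case: (eta) e1 e2 => /= ? ? -> ->.
Qed.

Lemma sqr_ieta : ('i%C * eta.1%:C) ^+ 2 + ('i%C * eta.2%:C) ^+ 2 =
    - t%:C ^+ 2 :> R[i].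
Proof.
rewrite !exprMn sqr_i !mulN1r -opprD; congr (- _).
by rewrite -!rmorphXn -rmorphD /= tau_sqr.
Qed.

Lemma symbolXE : symbolX lam mu eta =
  pencil mu%:C (lam + mu)%:C (t%:C ^+ 2) ('i%C * eta.1%:C) ('i%C * eta.2%:C).
Proof. by []. Qed.

Lemma det_symbol r : \det (symbol lam mu eta r) =
  mu%:C ^+ 2 * (lam + 2 * mu)%:C * (r ^+ 2 - t%:C ^+ 2) ^+ 3.
Proof.
rewrite det_scalar_add_rank1 bdot_col3 -!expr2 sqr_ieta.
rewrite !(rmorphD, rmorphM, rmorph_nat) /=; ring.
Qed.
End SymbolPencil.

(** * Integration over R^3 *)

Section Product.
Variable R : realType.
Local Notation mR := (measurableTypeR R).
Local Notation leb := (@lebesgue_measure R).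

(** Second countability in indexed form. The product sigma-algebra contains the rectangles, so open
    sets of a product are measurable once they are countable unions of basic rectangles. *)
Definition countable_base (T : topologicalType) (I : countType)
    (B : I -> set T) :=
  forall x A, nbhs x A -> exists i, B i x /\ B i `<=` A.

Lemma countable_base_prod (T U : topologicalType) (I J : countType)
    (B : I -> set T) (C : J -> set U) :
  countable_base B -> countable_base C ->
  countable_base (fun ij : I * J => B ij.1 `*` C ij.2).
Proof.
move=> hB hC [x y] A [[P Q] /= [/hB[i [Bx BP]] /hC[j [Cy CQ]]] PQA].
by exists (i, j); split=> // -[u v] [/= /BP ? /CQ ?]; exact: PQA.
Qed.

Lemma countable_base_itv :
  countable_base (fun q : rat * rat => `]ratr q.1, ratr q.2[%classic : set R).
Proof.
move=> x A /nbhs_ballP[e /= e0 eA].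
have /rat_in_itvoo[q1 /itvP h1] : x - e < x by rewrite ltrBlDr ltrDl.
have /rat_in_itvoo[q2 /itvP h2] : x < x + e by rewrite ltrDl.
exists (q1, q2); split => /=; first by rewrite in_itv /= h1 h2.
move=> y; rewrite /= in_itv /= => /andP[y1 y2]; apply: eA.
rewrite /ball /= ltr_distlC.
by rewrite (lt_trans _ y1) ?h1 // (lt_trans y2) ?h2.
Qed.

(** Indices whose basic set leaves [U] contribute the empty set, which keeps the union over the
    whole countable type. *)
Lemma open_bigcup_base (T : topologicalType) (I : countType)
    (B : I -> set T) (U : set T) :
  countable_base B -> open U ->
  U = \bigcup_i (if asbool (B i `<=` U) then B i else set0).
Proof.
move=> hB oU; apply/seteqP; split=> [x Ux|x [i _]];
  last by case: asboolP => // + ?; exact.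
have [i [Bx BU]] := hB x U (open_nbhs_nbhs (conj oU Ux)).
by exists i => //; case: asboolP.
Qed.

Lemma open_measurable2 (U : set (R * R)) :
  open U -> measurable (U : set (mR * mR)).
Proof.
move=> /(open_bigcup_base (countable_base_prod countable_base_itv
  countable_base_itv)) ->.
apply: (@countable_bigcupT_measurable _ (mR * mR)%type) => // q;
  case: asboolP => // _.
by apply: measurableX; exact: measurable_itv.
Qed.

Lemma open_measurable3 (U : set (R * R * R)) :
  open U -> measurable (U : set (mR * mR * mR)).
Proof.
move=> /(open_bigcup_base (countable_base_prod (countable_base_prod
  countable_base_itv countable_base_itv) countable_base_itv)) ->.
apply: (@countable_bigcupT_measurable _ (mR * mR * mR)%type) => // q;
  case: asboolP => // _.
by apply: measurableX; [apply: measurableX|]; exact: measurable_itv.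
Qed.

Lemma continuous_measurable2 (f : R * R -> R) : continuous f ->
  measurable_fun [set: mR * mR] f.
Proof.
move=> /continuousP cf; apply: (measurability _
  (measurable_realfun.RGenOpens.measurableE R)).
move=> _ [_ [a [b ->] <-]]; rewrite setTI; apply: open_measurable2.
exact/cf/interval_open.
Qed.

Lemma continuous_measurable3 (f : R * R * R -> R) : continuous f ->
  measurable_fun [set: mR * mR * mR] f.
Proof.
move=> /continuousP cf; apply: (measurability _
  (measurable_realfun.RGenOpens.measurableE R)).
move=> _ [_ [a [b ->] <-]]; rewrite setTI; apply: open_measurable3.
exact/cf/interval_open.
Qed.

(** Compact support enters only through a radius: vanishing beyond [M] passes directly to slices,
    products and derivatives. *)
Definition bounded_support (V : normedModType R) (W : zmodType) (f : V -> W) :=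
  exists M : R, forall x, M < `|x| -> f x = 0.

Local Notation seg M := (`[- M, M]%classic : set R).

Lemma compact_box2 (M : R) : compact (seg M `*` seg M).
Proof. by apply: compact_setX; exact: segment_compact. Qed.

Lemma compact_box3 (M : R) : compact (seg M `*` seg M `*` seg M).
Proof. by apply: compact_setX; [exact: compact_box2|exact: segment_compact].
  Qed.

Lemma leb_seg (M : R) : (leb (seg M) < +oo)%E.
Proof. exact/compact_finite_measure/segment_compact. Qed.

Lemma leb2_box (M : R) : ((leb \x leb) (seg M `*` seg M) < +oo)%E.
Proof.
have -> : (leb \x leb)%E (seg M `*` seg M) = (leb (seg M) * leb (seg M))%E.
  by apply: product_measure1E; exact: measurable_itv.
by rewrite lte_mul_pinfty // ?ge0_fin_numE // leb_seg.
Qed.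

Lemma leb3_box (M : R) : (@leb3 R (seg M `*` seg M `*` seg M) < +oo)%E.
Proof.
have -> : @leb3 R (seg M `*` seg M `*` seg M) =
    ((leb \x leb) (seg M `*` seg M) * leb (seg M))%E.
  by apply: product_measure1E; [apply: measurableX|]; exact: measurable_itv.
by rewrite lte_mul_pinfty // ?ge0_fin_numE // ?leb_seg // leb2_box.
Qed.

Lemma norm_le_seg (M x : R) : `|x| <= M -> seg M x.
Proof. by rewrite ler_norml /= in_itv. Qed.

(** The function equals its restriction to [D], where it is bounded and measurable on a set of
    finite measure. *)
Lemma integrable_bounded_support (d : measure_display) (T : measurableType d)
    (mu : {measure set T -> \bar R}) (D : set T) (f : T -> R) :
  measurable D -> (mu D < +oo)%E -> measurable_fun setT f ->
  [bounded f x | x in D] -> (forall x, ~ D x -> f x = 0) ->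
  mu.-integrable setT (EFin \o f).
Proof.
move=> mD muD mf bf f0.
have -> : EFin \o f = (EFin \o f) \_ D.
  apply/funext => x; rewrite patchE; case: ifPn => // /negP xD /=.
  by rewrite f0 // => /mem_set.
apply/(integrable_mkcond (EFin \o f) mD).1;
  apply: measurable_bounded_integrable => //.
exact: measurable_funTS.
Qed.

Lemma continuous_compact_bounded (T : topologicalType) (D : set T)
    (f : T -> R) :
  compact D -> continuous f -> [bounded f x | x in D].
Proof.
move=> cD cf.
have /compact_bounded[M [_ mrt]] :=
  continuous_compact (continuous_subspaceT cf) cD.
by exists M; split; rewrite ?num_real // => y My x Dx; apply: mrt => //;
  exists x.
Qed.

Lemma integrable2 (f : R * R -> R) : continuous f -> bounded_support f ->
  (leb \x leb)%E.-integrable [set: mR * mR] (EFin \o f).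
Proof.
move=> cf [M f0]; have bf := continuous_compact_bounded (@compact_box2 M) cf.
apply: (@integrable_bounded_support _ (mR * mR)%type _ (seg M `*` seg M)).
- by apply: measurableX; exact: measurable_itv.
- exact: leb2_box.
- exact: continuous_measurable2.
- exact: bf.
- move=> [x y] /= ND; apply: f0; rewrite ltNge; apply/negP => H; apply: ND.
  by move: H; rewrite prod_normE /= ge_max => /andP[? ?]; split;
    exact: norm_le_seg.
Qed.

Lemma integrable3 (f : R * R * R -> R) : continuous f -> bounded_support f ->
  (@leb3 R).-integrable [set: mR * mR * mR] (EFin \o f).
Proof.
move=> cf [M f0]; have bf := continuous_compact_bounded (@compact_box3 M) cf.
apply: (@integrable_bounded_support _ (mR * mR * mR)%type _
  (seg M `*` seg M `*` seg M)).
- by apply: measurableX; [apply: measurableX|]; exact: measurable_itv.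
- exact: leb3_box.
- exact: continuous_measurable3.
- exact: bf.
- move=> [[x y] z] /= ND; apply: f0; rewrite ltNge; apply/negP => H; apply: ND.
  move: H; rewrite prod_normE /= ge_max => /andP[+ ?];
    rewrite prod_normE /= ge_max => /andP[? ?].
  by do !split; exact: norm_le_seg.
Qed.
End Product.

(** * Directional derivatives as derivatives along lines *)

Section DeriveLine.
Variables (R : realType) (V : normedModType R).
Implicit Types (f : V -> R) (x v : V).

(** The two difference quotients are equal as functions, so existence and value of the limit
    transfer together. *)
Lemma is_derive_line f x v t d : is_derive (t *: v + x) v f d ->
  is_derive t 1 (fun h : R => f (h *: v + x)) d.
Proof.
have E : (fun h => h^-1 *:
      ((f \o shift (t *: v + x)) (h *: v) - f (t *: v + x))) =
    (fun h => h^-1 *: (((fun h : R => f (h *: v + x)) \o shift t) (h *: 1) -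
      f (t *: v + x))).
  by apply/funext => h /=; rewrite [h *: 1]mulr1 scalerDl addrA.
case; rewrite /derivable /derive E => df dE.
by apply: DeriveDef; rewrite /derivable /derive.
Qed.

Lemma is_derive_line0 f x v d :
  is_derive (0 : R) 1 (fun h : R => f (h *: v + x)) d ->
  is_derive x v f d.
Proof.
have E : (fun h => h^-1 *: ((f \o shift x) (h *: v) - f x)) =
    (fun h => h^-1 *: (((fun h : R => f (h *: v + x)) \o shift 0) (h *: 1) -
      f (0 *: v + x))).
  by apply/funext => h /=; rewrite [h *: 1]mulr1 addr0 scale0r add0r.
case; rewrite /derivable /derive -E => df dE.
by apply: DeriveDef; rewrite /derivable /derive.
Qed.

(** As [f] is known to have a derivative in one direction only, the one-variable chain rule is
    applied on the line through [x]. *)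
Lemma is_derive_comp (g : R -> R) f x v a b :
  is_derive (f x) 1 g a -> is_derive x v f b -> is_derive x v (g \o f) (a * b).
Proof.
move=> dg df; apply: is_derive_line0.
apply: (@is_derive1_comp _ g (fun h => f (h *: v + x))).
  by rewrite scale0r add0r.
by apply: is_derive_line; rewrite scale0r add0r.
Qed.

(** The region beyond radius [M] is open, so [f] vanishes near each of its points and the same
    radius serves for the derivative. *)
Lemma derive_bounded_support (M : R) f v : (forall x, M < `|x| -> f x = 0) ->
  forall x, M < `|x| -> 'D_v f x = 0.
Proof.
move=> f0 x Mx; rewrite (@near_eq_derive _ _ _ f (cst 0)) ?derive_cst //.
near=> y; rewrite /cst; apply: f0; near: y.
exact: (cvgr_gt _ (@norm_continuous _ _ x)).
Unshelve. all: by end_near. Qed.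

End DeriveLine.

(** * The one-dimensional integral of a derivative, and Fubini along the axes *)

Section IntegralDerivative.
Variable R : realType.
Local Notation mR := (measurableTypeR R).
Local Notation leb := (@lebesgue_measure R).
Local Open Scope ereal_scope.

Lemma integral_derive_bounded_support (g g' : R -> R) :
  (forall t : R, is_derive t 1%R g (g' t)) -> continuous g' ->
  bounded_support g -> \int[leb]_t (g' t)%:E = 0.
Proof.
move=> dg cg' [M g0].
have g'0 t : (M < `|t|)%R -> g' t = 0%R.
  move=> Mt; rewrite -(@derive_val _ _ _ _ _ _ _ (dg t)).
  exact: derive_bounded_support g0 _ Mt.
(* [M] may be negative; [N] is positive and strictly above [M], so [g] vanishes at both endpoints in
   the fundamental theorem. *)
pose N : R := (`|M| + 1)%R.
have N0 : (0 < N)%R by rewrite ltr_wpDl.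
have MN : (M < N)%R by rewrite (le_lt_trans (ler_norm M)) // ltrDl.
have cg : continuous g.
  by move=> t; apply/differentiable_continuous/derivable1_diffP;
    by have [] := dg t.
have -> : \int[leb]_t (g' t)%:E = \int[leb]_(t in `[(- N)%R, N]) (g' t)%:E.
  rewrite [RHS]integral_mkcond; congr (integral _ _ _); apply/funext => t.
  rewrite patchE; case: ifPn => // /negP tN; rewrite g'0 // ltNge;
    apply/negP => tM.
  by apply: tN; rewrite inE /= in_itv /= -ler_norml (le_trans tM) // ltW.
rewrite (@continuous_FTC2 _ g' g).
- by rewrite !g0 ?normrN ?gtr0_norm // subee.
- by rewrite gtrN.
- exact: continuous_subspaceT.
- split; [by move=> t _; have [] := dg t| |].
  + exact: cvg_at_right_filter (cg _).
  + exact: cvg_at_left_filter (cg _).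
- by move=> t _; rewrite derive1E; exact: derive_val.
Qed.

(** The squares of half-side [n] exhaust the plane. Fubini on the product of plane and line uses
    this for the first factor. *)
Let leb2_sigma_finite : sigma_finite [set: mR * mR] (leb \x leb).
Proof.
exists (fun n : nat => `[(- n%:R)%R, n%:R]%classic `*`
  `[(- n%:R)%R, n%:R]%classic).
  apply/seteqP; split=> // -[x y] _.
  exists (maxn (Num.truncn `|x|).+1 (Num.truncn `|y|).+1) => //=.
  split=> /=; rewrite in_itv /= -ler_norml (le_trans (ltW (truncnS_gt _))) //
    ler_nat leq_max ?leqnn ?orbT //.
move=> n; split; first by apply: measurableX; exact: measurable_itv.
exact: leb2_box.
Qed.

(* Canonical inference only finds the instance for products of
   subprobabilities, hence the explicit packing. *)
Let leb2 : {sigma_finite_measure set (mR * mR)%type -> \bar R} :=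
  HB.pack (leb \x leb) (Measure_isSigmaFinite.Build _ _ _ (leb \x leb)
    leb2_sigma_finite).

Section Slices.
Variable h : R * R * R -> R.
Hypotheses (ch : continuous h) (h0 : bounded_support h).

Let ih : (@leb3 R).-integrable [set: mR * mR * mR] (EFin \o h).
Proof. exact: integrable3. Qed.

Let slice_cont z : continuous (fun xy : R * R => h (xy, z)).
Proof.
move=> xy; apply: (@continuous_comp _ _ _ (fun xy : R * R => (xy, z)) h);
  last exact: ch.
by apply: (@cvg_pair _ _ _ _ (nbhs xy) (nbhs z));
  [exact: cvg_id|exact: cvg_cst].
Qed.

Let slice_supp z : bounded_support (fun xy : R * R => h (xy, z)).
Proof.
have [M hM] := h0; exists M => xy Mxy; apply: hM.
by rewrite prod_normE /= lt_max Mxy.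
Qed.

Let fubini12 :=
  @integral12_prod_meas1 _ _ (mR * mR)%type mR R leb2 leb (EFin \o h) ih.
Let fubini21 :=
  @integral21_prod_meas1 _ _ (mR * mR)%type mR R leb2 leb (EFin \o h) ih.

Let slice12 z := @integral12_prod_meas1 _ _ mR mR R leb leb _
  (integrable2 (@slice_cont z) (slice_supp z)).
Let slice21 z := @integral21_prod_meas1 _ _ mR mR R leb leb _
  (integrable2 (@slice_cont z) (slice_supp z)).

Lemma integral_slice2 : (forall x y, \int[leb]_z (h (x, y, z))%:E = 0) ->
  \int[@leb3 R]_p (h p)%:E = 0.
Proof.
move=> H; transitivity (\int[leb2]_x fubini_F leb (EFin \o h) x);
  first by rewrite fubini12.
by rewrite /fubini_F integral0_eq // => -[x y] _; exact: H.
Qed.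

(** Fubini twice: the third variable is made outermost, then the second innermost on each horizontal
    slice, which is again continuous with bounded support. *)
Lemma integral_slice1 : (forall x z, \int[leb]_y (h (x, y, z))%:E = 0) ->
  \int[@leb3 R]_p (h p)%:E = 0.
Proof.
move=> H; transitivity (\int[leb]_z fubini_G leb2 (EFin \o h) z);
  first by rewrite fubini21.
rewrite integral0_eq // => z _.
transitivity (\int[leb]_x fubini_F leb (EFin \o (fun xy => h (xy, z))) x);
  first by rewrite slice12.
by rewrite integral0_eq // => x _; exact: H.
Qed.

Lemma integral_slice0 : (forall y z, \int[leb]_x (h (x, y, z))%:E = 0) ->
  \int[@leb3 R]_p (h p)%:E = 0.
Proof.
move=> H; transitivity (\int[leb]_z fubini_G leb2 (EFin \o h) z);
  first by rewrite fubini21.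
rewrite integral0_eq // => z _.
transitivity (\int[leb]_x fubini_G leb (EFin \o (fun xy => h (xy, z))) x);
  first by rewrite slice21.
by rewrite integral0_eq // => x _; exact: H.
Qed.
End Slices.
End IntegralDerivative.

Section PartialIntegral.
Variable R : realType.
Local Notation R3 := (R * R * R)%type.
Local Notation mR := (measurableTypeR R).

Lemma integral_partial_bounded_support (k : 'I_3) (F : R3 -> R) :
  (forall x, derivable F x (std_dir R k)) -> continuous ('D_(std_dir R k) F) ->
  bounded_support F -> (\int[@leb3 R]_p ('D_(std_dir R k) F p)%:E = 0)%E.
Proof.
move=> dF cF [M F0].
have F'0 : bounded_support ('D_(std_dir R k) F).
  by exists M => x; exact: derive_bounded_support F0 x.
(* [w] parametrises a line parallel to the [k]-th axis; the norm inequality carries the bounded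
   support of [F] over to the line. *)
have line (u : R3) (w : R -> R3) : (forall t, w t = t *: std_dir R k + u) ->
    continuous w -> (forall t, `|t| <= `|w t|) ->
    (\int[@lebesgue_measure R]_t ('D_(std_dir R k) F (w t))%:E = 0)%E.
  move=> wE cw wn; apply: (@integral_derive_bounded_support R (F \o w)).
  - move=> t; have -> : F \o w = fun t => F (t *: std_dir R k + u).
      by apply/funext => s /=; rewrite wE.
    by apply: is_derive_line; rewrite -wE; exact: derivableP.
  - by move=> t; have := continuous_comp (cw t) (cF (w t)).
  - by exists M => t Mt; apply: F0; rewrite (lt_le_trans Mt).
have pairc (a b c : R -> R) : continuous a -> continuous b -> continuous c ->
    continuous (fun t => (a t, b t, c t) : R3).
  move=> ca cb cc t; apply: (@cvg_pair _ _ _ _ (nbhs (a t, b t)) (nbhs (c t)));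
    last exact: cc.
  by apply: (@cvg_pair _ _ _ _ (nbhs (a t)) (nbhs (b t)));
    [exact: ca|exact: cb].
have cst_c (a : R) : continuous (fun _ : R => a) by move=> ?; exact: cvg_cst.
have id_c : continuous (fun t : R => t) by move=> ?; exact: cvg_id.
have scaleE (t : R) (a b c x y z : R) : t *: ((a, b, c) : R3) + (x, y, z) =
  (t * a + x, t * b + y, t * c + z) by [].
move: k dF cF F'0 line; case=> [[|[|[|//]]] hk] dF cF F'0 line.
- apply: integral_slice0 => // y z; apply: (line (0, y, z)
    (fun t => (t, y, z))).
  + by move=> t; rewrite scaleE /= !(mulr1, mulr0, addr0, add0r).
  + exact: pairc.
  + by move=> t; rewrite !prod_normE /= !le_max lexx.
- apply: integral_slice1 => // x z; apply: (line (x, 0, z)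
    (fun t => (x, t, z))).
  + by move=> t; rewrite scaleE /= !(mulr1, mulr0, addr0, add0r).
  + exact: pairc.
  + by move=> t; rewrite !prod_normE /= !le_max lexx orbT.
- apply: integral_slice2 => // x y; apply: (line (x, y, 0)
    (fun t => (x, y, t))).
  + by move=> t; rewrite scaleE /= !(mulr1, mulr0, addr0, add0r).
  + exact: pairc.
  + by move=> t; rewrite !prod_normE /= !le_max lexx orbT.
Qed.

End PartialIntegral.

(** * Integration by parts for complex-valued functions *)

Section ComplexCalculus.
Variable R : realType.
Local Notation C := R[i].
Local Notation R3 := (R * R * R)%type.
Local Notation Re := (@complex.Re R).
Local Notation Im := (@complex.Im R).
Implicit Types (f g : R3 -> C) (x v : R3) (a b : C).

Lemma complex_ReD a b : Re (a + b) = Re a + Re b.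
Proof. by case: a; case: b. Qed.
Lemma complex_ImD a b : Im (a + b) = Im a + Im b.
Proof. by case: a; case: b. Qed.
Lemma complex_ReM a b : Re (a * b) = Re a * Re b - Im a * Im b.
Proof. by case: a; case: b. Qed.
Lemma complex_ImM a b : Im (a * b) = Re a * Im b + Im a * Re b.
Proof. by case: a; case: b. Qed.
Lemma complex_eq a b : Re a = Re b -> Im a = Im b -> a = b.
Proof. by case: a => ? ?; case: b => ? ? /= -> ->. Qed.

Definition ccontinuous f := continuous (re_fun f) /\ continuous (im_fun f).

(** Existence and value are stated together for the real and imaginary parts, so that the rules
    below determine [pderiv] through [pderivE]. *)
Definition is_cderive x v f (d : C) :=
  is_derive x v (re_fun f) (Re d) /\ is_derive x v (im_fun f) (Im d).

Lemma re_funD f g : re_fun (fun y => f y + g y) = re_fun f + re_fun g.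
Proof. by apply/funext => y; rewrite /re_fun complex_ReD. Qed.
Lemma im_funD f g : im_fun (fun y => f y + g y) = im_fun f + im_fun g.
Proof. by apply/funext => y; rewrite /im_fun complex_ImD. Qed.
Lemma re_funM f g : re_fun (fun y => f y * g y) =
    re_fun f * re_fun g - im_fun f * im_fun g.
Proof. by apply/funext => y; rewrite /re_fun complex_ReM. Qed.
Lemma im_funM f g : im_fun (fun y => f y * g y) =
    re_fun f * im_fun g + im_fun f * re_fun g.
Proof. by apply/funext => y; rewrite /im_fun complex_ImM. Qed.

Lemma ccontinuousD f g : ccontinuous f -> ccontinuous g ->
    ccontinuous (fun x => f x + g x).
Proof.
move=> [rf jf] [rg jg]; rewrite /ccontinuous re_funD im_funD.
by split=> x; apply: cvgD; [exact: rf|exact: rg|exact: jf|exact: jg].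
Qed.

Lemma ccontinuousM f g : ccontinuous f -> ccontinuous g ->
    ccontinuous (fun x => f x * g x).
Proof.
move=> [rf jf] [rg jg]; rewrite /ccontinuous re_funM im_funM; split=> x.
  by apply: cvgB; apply: cvgM; [exact: rf|exact: rg|exact: jf|exact: jg].
by apply: cvgD; apply: cvgM; [exact: rf|exact: jg|exact: jf|exact: rg].
Qed.

Lemma ccontinuous_cst a : ccontinuous (fun _ => a).
Proof. by split=> x; exact: cvg_cst. Qed.

Lemma ccontinuous_real (h : R3 -> R) : continuous h ->
    ccontinuous (fun x => (h x)%:C).
Proof. by move=> ch; split=> //= x; exact: cvg_cst. Qed.

Lemma ccontinuous_cexp f : ccontinuous f -> ccontinuous (fun x => cexp (f x)).
Proof.
move=> [rf jf]; split=> x; apply: cvgM.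
- exact: (continuous_comp (rf x) (@continuous_expR R _)).
- exact: (continuous_comp (jf x) (@continuous_cos R _)).
- exact: (continuous_comp (rf x) (@continuous_expR R _)).
- exact: (continuous_comp (jf x) (@continuous_sin R _)).
Qed.

Lemma is_cderiveD x v f g a b : is_cderive x v f a -> is_cderive x v g b ->
  is_cderive x v (fun y => f y + g y) (a + b).
Proof.
move=> [rf jf] [rg jg]; split.
  by rewrite re_funD complex_ReD; exact: is_deriveD.
by rewrite im_funD complex_ImD; exact: is_deriveD.
Qed.

Lemma is_cderiveM x v f g a b : is_cderive x v f a -> is_cderive x v g b ->
  is_cderive x v (fun y => f y * g y) (f x * b + a * g x).
Proof.
move=> [rf jf] [rg jg]; split.
  rewrite re_funM; apply: is_derive_eq.
  by rewrite complex_ReD !complex_ReM /re_fun /im_fun /GRing.scale /=; ring.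
rewrite im_funM; apply: is_derive_eq.
by rewrite complex_ImD !complex_ImM /re_fun /im_fun /GRing.scale /=; ring.
Qed.

Lemma is_cderive_cst x v a : is_cderive x v (fun _ => a) 0.
Proof. by split; exact: is_derive_cst. Qed.

Lemma is_cderive_real x v (h : R3 -> R) d : is_derive x v h d ->
  is_cderive x v (fun x => (h x)%:C) d%:C.
Proof. by move=> dh; split=> //=; exact: is_derive_cst. Qed.

Lemma is_cderive_cexp x v f a : is_cderive x v f a ->
  is_cderive x v (fun y => cexp (f y)) (a * cexp (f x)).
Proof.
move=> [rf jf].
have dE := is_derive_comp (is_derive_expR (re_fun f x)) rf.
have dC := is_derive_comp (is_derive_cos (im_fun f x)) jf.
have dS := is_derive_comp (is_derive_sin (im_fun f x)) jf.
split.
  have -> : re_fun (fun y => cexp (f y)) =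
      (expR \o re_fun f) * (@cos R \o im_fun f) by [].
  by apply: is_derive_eq; rewrite complex_ReM /re_fun /im_fun /GRing.scale /=;
    ring.
have -> : im_fun (fun y => cexp (f y)) =
    (expR \o re_fun f) * (@sin R \o im_fun f) by [].
by apply: is_derive_eq; rewrite complex_ImM /re_fun /im_fun /GRing.scale /=;
  ring.
Qed.

Lemma pderivE k f x a : is_cderive x (std_dir R k) f a -> pderiv k f x = a.
Proof. by move=> [[_ rf] [_ jf]]; rewrite /pderiv rf jf; case: a {rf jf}. Qed.

End ComplexCalculus.

(** * Functions of class C^1 and C^2, linearity of the complex integral, integration by parts *)

Section IntegrationByParts.
Variable R : realType.
Local Notation C := R[i].
Local Notation R3 := (R * R * R)%type.
Local Notation mR := (measurableTypeR R).
Local Notation Re := (@complex.Re R).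
Local Notation Im := (@complex.Im R).
Implicit Types (f g phi : R3 -> C) (a b : C).

(** Integration by parts differentiates a product once. Smooth functions are therefore weakened to
    finite order, and only first-order regularity is shown stable under products. *)
Definition class_C1 f := ccontinuous f /\ forall k,
  (forall x, is_cderive x (std_dir R k) f (pderiv k f x)) /\
  ccontinuous (pderiv k f).

Definition class_C2 f := class_C1 f /\ forall k, class_C1 (pderiv k f).

Lemma smooth_C1 f : smooth f -> class_C1 f.
Proof.
move=> sf; have [rf jf df] := sf [::]; split=> // k; split;
  last by have [] := sf [:: k].
by move=> x; have [? ?] := df k x; split; exact: derivableP.
Qed.

(** [foldr] applies the last entry of the list first, so [k] is appended at the end. *)
Lemma smooth_pderiv k f : smooth f -> smooth (pderiv k f).
Proof. by move=> sf s; have := sf (rcons s k); rewrite foldr_rcons. Qed.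

Lemma smooth_C2 f : smooth f -> class_C2 f.
Proof.
by move=> sf; split=> [|k]; apply: smooth_C1 => //; exact: smooth_pderiv.
Qed.

Lemma pderivD k f g : class_C1 f -> class_C1 g ->
  pderiv k (fun x => f x + g x) = fun x => pderiv k f x + pderiv k g x.
Proof.
move=> [_ /(_ k)[df _]] [_ /(_ k)[dg _]]; apply/funext => x; apply: pderivE.
exact: is_cderiveD.
Qed.

Lemma pderivM k f g : class_C1 f -> class_C1 g ->
  pderiv k (fun x => f x * g x) = fun x => f x * pderiv k g x +
    pderiv k f x * g x.
Proof.
move=> [_ /(_ k)[df _]] [_ /(_ k)[dg _]]; apply/funext => x; apply: pderivE.
exact: is_cderiveM.
Qed.

Lemma class_C1D f g : class_C1 f -> class_C1 g -> class_C1 (fun x => f x + g x).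
Proof.
move=> c1f c1g; have [cf df] := c1f; have [cg dg] := c1g.
split; first exact: ccontinuousD.
move=> k; rewrite pderivD //; split; last by apply: ccontinuousD;
  [case: (df k)|case: (dg k)].
by move=> x; apply: is_cderiveD; [case: (df k)|case: (dg k)].
Qed.

Lemma class_C1M f g : class_C1 f -> class_C1 g -> class_C1 (fun x => f x * g x).
Proof.
move=> c1f c1g; have [cf df] := c1f; have [cg dg] := c1g.
split; first exact: ccontinuousM.
move=> k; have [dfk cfk] := df k; have [dgk cgk] := dg k; rewrite pderivM //;
  split.
  by move=> x; apply: is_cderiveM.
by apply: ccontinuousD; apply: ccontinuousM.
Qed.

Lemma class_C1_cst a : class_C1 (fun=> a).
Proof.
have dE k : pderiv k (fun=> a) = fun=> 0.
  by apply/funext => x; apply: pderivE; exact: is_cderive_cst.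
split; first exact: ccontinuous_cst.
by move=> k; rewrite dE; split; [move=> x;
  exact: is_cderive_cst|exact: ccontinuous_cst].
Qed.

Lemma class_C1_sum n (F : 'I_n -> R3 -> C) : (forall i, class_C1 (F i)) ->
  class_C1 (fun x => \sum_i F i x) /\
  forall k, pderiv k (fun x => \sum_i F i x) = fun x => \sum_i pderiv k (F i) x.
Proof.
elim: n F => [|n IH] F c1F.
  under eq_fun do rewrite big_ord0; split; first exact: class_C1_cst.
  by move=> k; apply/funext => x; rewrite big_ord0; apply: pderivE;
    exact: is_cderive_cst.
have [c1 d1] := IH (fun i => F (widen_ord (leqnSn n) i)) (fun i => c1F _).
have E : (fun x => \sum_(i < n.+1) F i x) =
    fun x => \sum_(i < n) F (widen_ord (leqnSn n) i) x + F ord_max x.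
  by apply/funext => x; rewrite big_ord_recr.
rewrite E; split; first exact: class_C1D.
by move=> k; rewrite pderivD // d1; apply/funext => x;
  rewrite [RHS]big_ord_recr.
Qed.

Lemma bounded_support_pderiv k f : bounded_support f ->
    bounded_support (pderiv k f).
Proof.
move=> [M f0]; exists M => x Mx; apply: complex_eq => /=.
  by apply: (derive_bounded_support (M := M)) => // y My; rewrite /re_fun f0.
by apply: (derive_bounded_support (M := M)) => // y My; rewrite /im_fun f0.
Qed.

Lemma bounded_supportMl f g : bounded_support g ->
    bounded_support (fun x => f x * g x).
Proof. by move=> [M g0]; exists M => x Mx; rewrite g0 // mulr0. Qed.

Lemma bounded_supportD f g : bounded_support f -> bounded_support g ->
  bounded_support (fun x => f x + g x).
Proof.
move=> [M f0] [N g0]; exists (Num.max M N) => x; rewrite gt_max => /andP[Mx Nx].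
by rewrite f0 // g0 // addr0.
Qed.

(** The class of integrands on which [cintegral] is linear, integrability being automatic. *)
Definition ccontinuous_bs f := ccontinuous f /\ bounded_support f.

Lemma ccontinuous_bsD f g : ccontinuous_bs f -> ccontinuous_bs g ->
  ccontinuous_bs (fun x => f x + g x).
Proof.
by move=> [? ?] [? ?]; split; [exact: ccontinuousD|exact: bounded_supportD].
Qed.

Lemma ccontinuous_bsM f g : ccontinuous f -> ccontinuous_bs g ->
  ccontinuous_bs (fun x => f x * g x).
Proof.
by move=> ? [? ?]; split; [exact: ccontinuousM|exact: bounded_supportMl].
Qed.

Lemma ccontinuous_bsZ a f : ccontinuous_bs f ->
    ccontinuous_bs (fun x => a * f x).
Proof. by move=> okf; apply: ccontinuous_bsM => //; exact: ccontinuous_cst. Qed.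

Lemma ccontinuous_bs_integrable f : ccontinuous_bs f ->
  (@leb3 R).-integrable [set: mR * mR * mR] (EFin \o re_fun f) /\
  (@leb3 R).-integrable [set: mR * mR * mR] (EFin \o im_fun f).
Proof.
move=> [[rf jf] [M f0]]; split; apply: integrable3 => //; exists M => x Mx.
  by rewrite /re_fun f0.
by rewrite /im_fun f0.
Qed.

Lemma cintegralD f g : ccontinuous_bs f -> ccontinuous_bs g ->
  cintegral (fun x => f x + g x) = cintegral f + cintegral g.
Proof.
move=> /ccontinuous_bs_integrable[rf jf] /ccontinuous_bs_integrable[rg jg].
by apply: complex_eq; rewrite ?complex_ReD ?complex_ImD /= ?re_funD ?im_funD;
  apply: RintegralD.
Qed.

Lemma cintegralZ a f : ccontinuous_bs f -> cintegral (fun x => a * f x) =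
    a * cintegral f.
Proof.
move=> /ccontinuous_bs_integrable[rf jf].
have Z r (h : R3 -> R) : (@leb3 R).-integrable [set: mR * mR * mR] (EFin \o h)
    ->
    (@leb3 R).-integrable [set: mR * mR * mR] (EFin \o (fun x => r * h x)).
  by move=> ih; have := @integrableZl _ (mR * mR * mR)%type R (@leb3 R) setT
    measurableT r _ ih.
apply: complex_eq; rewrite ?complex_ReM ?complex_ImM /= ?re_funM ?im_funM.
  have -> : re_fun (fun _ : R3 => a) * re_fun f - im_fun (fun _ :
      R3 => a) * im_fun f
    = (fun x => Re a * re_fun f x - Im a * im_fun f x) by [].
  by rewrite RintegralB ?RintegralZl //; exact: Z.
have -> : re_fun (fun _ : R3 => a) * im_fun f + im_fun (fun _ :
    R3 => a) * re_fun f
    = (fun x => Re a * im_fun f x + Im a * re_fun f x) by [].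
by rewrite RintegralD ?RintegralZl //; exact: Z.
Qed.

Lemma cintegral_lin2 a b f g : ccontinuous_bs f -> ccontinuous_bs g ->
  ccontinuous_bs (fun x => a * f x + b * g x) /\
  cintegral (fun x => a * f x + b * g x) = a * cintegral f + b * cintegral g.
Proof.
move=> okf okg; have ? := ccontinuous_bsZ a okf;
  have ? := ccontinuous_bsZ b okg.
by split; [exact: ccontinuous_bsD|rewrite cintegralD ?cintegralZ].
Qed.

Lemma cintegral_sum n (F : 'I_n -> R3 -> C) :
    (forall i, ccontinuous_bs (F i)) ->
  ccontinuous_bs (fun x => \sum_i F i x) /\
  cintegral (fun x => \sum_i F i x) = \sum_i cintegral (F i).
Proof.
elim: n F => [|n IH] F cF.
  have -> : (fun x => \sum_(i < 0) F i x) = fun=> 0 by apply/funext => x;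
      rewrite big_ord0.
  split; first by split; [exact: ccontinuous_cst|exists 0].
  by rewrite big_ord0 /cintegral; apply: complex_eq;
    rewrite /= /Rintegral integral0.
have [c1 d1] := IH (fun i => F (widen_ord (leqnSn n) i)) (fun i => cF _).
have -> : (fun x => \sum_(i < n.+1) F i x) =
    fun x => \sum_(i < n) F (widen_ord (leqnSn n) i) x + F ord_max x.
  by apply/funext => x; rewrite big_ord_recr.
by split; [exact: ccontinuous_bsD|rewrite cintegralD // d1 [RHS]big_ord_recr].
Qed.

Lemma cintegral_pderiv k f : class_C1 f -> bounded_support f ->
    cintegral (pderiv k f) = 0.
Proof.
move=> [_ /(_ k)[df [cr ci]]] [M f0].
have dr x : derivable (re_fun f) x (std_dir R k) by have [[]] := df x.
have di x : derivable (im_fun f) x (std_dir R k) by have [_ []] := df x.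
apply: complex_eq; rewrite /= /Rintegral.
  rewrite (@integral_partial_bounded_support R k (re_fun f)) //.
  by exists M => x Mx; rewrite /re_fun f0.
rewrite (@integral_partial_bounded_support R k (im_fun f)) //.
by exists M => x Mx; rewrite /im_fun f0.
Qed.

(** The product [f phi] inherits the bounded support of [phi], so its partial derivative integrates
    to zero. *)
Lemma cintegral_by_parts k f phi : class_C1 f -> class_C1 phi ->
    bounded_support phi ->
  cintegral (fun x => f x * pderiv k phi x) =
    - cintegral (fun x => pderiv k f x * phi x).
Proof.
move=> c1f c1p sp; apply/eqP; rewrite -addr_eq0 -cintegralD.
- rewrite -pderivM // cintegral_pderiv //; first exact: class_C1M.
  exact: bounded_supportMl.
- apply: ccontinuous_bsM; first by case: c1f.
  by split; [case: c1p => _ /(_ k)[]|exact: bounded_support_pderiv].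
- apply: ccontinuous_bsM; first by case: c1f => _ /(_ k)[].
  by split; [case: c1p|].
Qed.

Lemma test_function_bounded_support phi : test_function phi ->
    bounded_support phi.
Proof.
(* The bound holds for every radius strictly above [M], whence [M + 1]. *)
move=> [_ /compact_bounded[M [_ HM]]]; exists (M + 1) => x Mx; apply/eqP.
apply: contraLR Mx => x0; rewrite -leNgt; apply: (HM (M + 1));
  first by rewrite ltrDl.
exact: subset_closure.
Qed.

(** On a compact set the squared modulus is bounded; the set is measurable because it is closed, and
    of finite measure because a box contains it. *)
Lemma ccontinuous_L2loc f : ccontinuous f -> L2loc f.
Proof.
move=> [rf jf]; split; [exact: continuous_measurable3|exact:
  continuous_measurable3|].
move=> A cA; set h := fun x => re_fun f x ^+ 2 + im_fun f x ^+ 2.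
have ch : continuous h.
  by move=> x; apply: cvgD; under eq_fun do rewrite expr2; apply: cvgM;
    [exact: rf|exact: rf|exact: jf|exact: jf].
have mA : measurable (A : set (mR * mR * mR)).
  rewrite -[A]setCK; apply: measurableC; apply: open_measurable3;
    apply: closed_openC.
  exact: compact_closed (@norm_hausdorff _ _) cA.
have bh := continuous_compact_bounded cA ch.
have ih : (@leb3 R).-integrable (A : set (mR * mR * mR)) (EFin \o h).
  apply: measurable_bounded_integrable => //; last first.
    by apply: measurable_funTS; exact: continuous_measurable3.
  have [M [_ AM]] := compact_bounded cA.
  apply: (@le_lt_trans _ _ (@leb3 R (`[- (M + 1), M + 1]%classic `*` `[- (M +
    1), M + 1]%classic `*` `[- (M + 1), M + 1]%classic))); last exact: leb3_box.
  apply: le_measure; rewrite ?inE //.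
    by apply: measurableX; [apply: measurableX|]; exact: measurable_itv.
  have {}AM := AM (M + 1) (ltr_pwDr ltr01 (lexx _)).
  move=> [[x y] z] /AM /=; rewrite !prod_normE /= !ge_max =>
    /andP[/andP[xM yM] zM].
  by do !split; exact: norm_le_seg.
exact: integrable_lty ih.
Qed.

End IntegrationByParts.

(** * The Lame system *)

Section WeakLame.
Variable R : realType.
Local Notation C := R[i].
Local Notation R3 := (R * R * R)%type.
Implicit Types (v phi : R3 -> 'cV[C]_3).

Lemma lameE lam mu v x k : lame lam mu v x k 0 =
  mu%:C * (\sum_j pderiv j (pderiv j (component v k)) x) +
  (lam + mu)%:C * pderiv k (divergence v) x.
Proof. by rewrite !mxE. Qed.

(** The classical partial derivatives serve as weak ones. *)
Lemma smooth_H1loc v : (forall k, smooth (component v k)) -> H1loc v.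
Proof.
move=> sv j; have [c1 _] := smooth_C2 (sv j); have [cv dv] := c1.
split; first exact: ccontinuous_L2loc.
move=> k; exists (pderiv k (component v j));
  first by apply: ccontinuous_L2loc; case: (dv k).
move=> phi tphi; apply: cintegral_by_parts => //;
  last exact: test_function_bounded_support.
by apply: smooth_C1; case: tphi.
Qed.

Lemma classical_weak_lame_solution lam mu v :
  (forall k, smooth (component v k)) -> (forall x, lame lam mu v x = 0) ->
  weak_lame_solution lam mu v.
Proof.
move=> sv Lv phi tphi.
pose V := component v; pose P := component phi.
have c2V k : class_C2 (V k) := smooth_C2 (sv k).
have c2P k : class_C2 (P k) by apply: smooth_C2; case: (tphi k).
have bP k : bounded_support (P k) := test_function_bounded_support (tphi k).
have c1V k : class_C1 (V k) by case: (c2V k).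
have c1P k : class_C1 (P k) by case: (c2P k).
have dV j k : class_C1 (pderiv j (V k)) by case: (c2V k) => _; exact.
have dP j k : class_C1 (pderiv j (P k)) by case: (c2P k) => _; exact.
have ddV i j k : ccontinuous (pderiv i (pderiv j (V k)))
    by case: (dV j k) => _ /(_ i)[].
have ddP i j k : ccontinuous (pderiv i (pderiv j (P k)))
    by case: (dP j k) => _ /(_ i)[].
have cc (f : R3 -> C) : class_C1 f -> ccontinuous f by case.
have bdP j k : bounded_support (pderiv j (P k))
    by exact: bounded_support_pderiv.
have bddP i j k : bounded_support (pderiv i (pderiv j (P k)))
    by exact: bounded_support_pderiv.
have [c1div dDiv] := class_C1_sum (fun k => dP k k).
have [_ dDivV] := class_C1_sum (fun k => dV k k).
have bdiv : bounded_support (divergence phi).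
  by have [] := cintegral_sum (fun k => conj (cc _ (dP k k)) (bdP k k)) => -[].
have okdiv k : ccontinuous_bs (pderiv k (divergence phi)).
  by split; [case: c1div => _ /(_ k)[]|exact: bounded_support_pderiv].
set m := mu%:C; set l := (lam + mu)%:C.
have okA j k : ccontinuous_bs (fun x => V k x * pderiv j (pderiv j (P k)) x).
  by apply: ccontinuous_bsM; [exact: cc|split].
have okB k : ccontinuous_bs (fun x => V k x * pderiv k (divergence phi) x).
  by apply: ccontinuous_bsM; [exact: cc|].
have okA' j k : ccontinuous_bs (fun x => pderiv j (pderiv j (V k)) x * P k x).
  by apply: ccontinuous_bsM; [|split; [exact: cc|]].
have okB' k j : ccontinuous_bs (fun x => pderiv j (pderiv k (V k)) x * P j x).
  by apply: ccontinuous_bsM; [|split; [exact: cc|]].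
have IA j k : cintegral (fun x => V k x * pderiv j (pderiv j (P k)) x)
    = cintegral (fun x => pderiv j (pderiv j (V k)) x * P k x).
  by rewrite cintegral_by_parts // cintegral_by_parts // opprK.
(* The derivatives fall on [v] in the order in which [grad div] needs them, so
   the symmetry of second derivatives is not used. *)
have IB k : cintegral (fun x => V k x * pderiv k (divergence phi) x)
    = \sum_j cintegral (fun x => pderiv j (pderiv k (V k)) x * P j x).
  rewrite cintegral_by_parts // /divergence.
  have -> : (fun x => pderiv k (V k) x * (\sum_(j < 3) pderiv j (P j) x)) =
      fun x => \sum_(j < 3) pderiv k (V k) x * pderiv j (P j) x.
    by apply/funext => x; rewrite mulr_sumr.
  have [_ ->] := cintegral_sum (fun j =>
    ccontinuous_bsM (cc _ (dV k k)) (conj (cc _ (dP j j)) (bdP j j))).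
  rewrite -sumrN; apply: eq_bigr => j _.
  by rewrite cintegral_by_parts // opprK.
have E : (fun x => bdot (v x) (lame lam mu phi x)) =
    fun x => \sum_(k < 3)
      (m * (\sum_(j < 3) V k x * pderiv j (pderiv j (P k)) x)
       + l * (V k x * pderiv k (divergence phi) x)).
  apply/funext => x; apply: eq_bigr => k _;
    rewrite lameE -/m -/l mulrDr mulrCA -mulr_sumr.
  by congr (_ + _); rewrite mulrCA.
have E' : (fun x => bdot (lame lam mu v x) (phi x)) =
    fun x => \sum_(k < 3)
      (m * (\sum_(j < 3) pderiv j (pderiv j (V k)) x * P k x)
       + l * (\sum_(j < 3) pderiv k (pderiv j (V j)) x * P k x)).
  apply/funext => x; apply: eq_bigr => k _; rewrite lameE mulrDl -!mulrA;
    congr (_ * _ + _ * _).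
    by rewrite mulr_suml.
  by rewrite /divergence dDivV mulr_suml.
have okAs k := cintegral_sum (fun j => okA j k).
have okAs' k := cintegral_sum (fun j => okA' j k).
have okBs' k := cintegral_sum (fun j => okB' j k).
(* The zero integrand is written [0 * 0] so that homogeneity of the integral evaluates it. The goal
   then becomes the symmetry of the bilinear pairing. *)
have -> : 0 = cintegral (fun x => bdot (lame lam mu v x) (phi x)).
  have -> : (fun x => bdot (lame lam mu v x) (phi x)) = fun=> 0 * 0.
    by apply/funext => x; rewrite Lv /bdot big1 ?mulr0 // => k _;
      rewrite mxE mul0r.
  rewrite cintegralZ ?mul0r //; split; [exact: ccontinuous_cst|by exists 0].
rewrite E E'.
have L k := cintegral_lin2 m l (okAs k).1 (okB k).
have L' k := cintegral_lin2 m l (okAs' k).1 (okBs' k).1.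
have [_ ->] := cintegral_sum (fun k => (L k).1).
have [_ ->] := cintegral_sum (fun k => (L' k).1).
transitivity (\sum_k (m * (\sum_j cintegral (fun x =>
  pderiv j (pderiv j (V k)) x * P k x))
    + l * (\sum_j cintegral (fun x => pderiv j (pderiv k (V k)) x * P j x)))).
  apply: eq_bigr => k _; rewrite (L k).2 (okAs k).2 IB; congr (_ * _ + _).
  by apply: eq_bigr => j _; rewrite IA.
transitivity (\sum_k (m * (\sum_j cintegral (fun x =>
  pderiv j (pderiv j (V k)) x * P k x))
    + l * (\sum_j cintegral (fun x => pderiv k (pderiv j (V j)) x * P k x)))).
  (* Integration by parts pairs [d_j d_k V_k] with [P_j], the operator pairs [d_k d_j V_j] with
     [P_k]; the double sums agree after exchanging the indices. *)
  have swap (A : 'I_3 -> C) (B : 'I_3 -> 'I_3 -> C) :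
      \sum_k (m * A k + l * \sum_j B k j) = \sum_k (m * A k + l * \sum_j B j k).
    by rewrite big_split [RHS]big_split -!mulr_sumr [in RHS]exchange_big.
  exact: (swap (fun k => \sum_j cintegral (fun x =>
    pderiv j (pderiv j (V k)) x * P k x))
    (fun k j => cintegral (fun x => pderiv j (pderiv k (V k)) x * P j x))).
apply: eq_bigr => k _.
apply: esym; apply: etrans (L' k).2 _.
exact: (congr2 (fun u w => m * u + l * w) (okAs' k).2 (okBs' k).2).
Qed.
End WeakLame.

(** * Plane waves with amplitude affine in the third variable *)

Section PlaneWave.
Variables (R : realType) (eta : R * R) (r : R[i]).
Local Notation C := R[i].
Local Notation R3 := (R * R * R)%type.
Implicit Types (a b : C) (k : 'I_3).

Definition affine_wave a b (x : R3) : C := (a * x.2%:C + b) * plane_exp eta r x.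

Lemma is_derive_linear (L : R3 -> R) :
  (forall (h : R) v x, L (h *: v + x) = h * L v + L x) ->
  forall x v, is_derive x v L (L v).
Proof.
move=> hL x v; apply: is_derive_line0.
have -> : (fun h : R => L (h *: v + x)) = (fun h : R => h * L v + L x).
  by apply/funext => h; rewrite hL.
by apply: is_derive_eq; rewrite /GRing.scale /=; ring.
Qed.

Lemma plane_phase_cderive x v :
  is_cderive x v (fun y : R3 =>
    'i%C * (eta.1 * y.1.1 + eta.2 * y.1.2)%:C + r * y.2%:C)
   ('i%C * (eta.1 * v.1.1 + eta.2 * v.1.2)%:C + r * v.2%:C).
Proof.
have lin1 := @is_derive_linear (fun y : R3 => eta.1 * y.1.1 + eta.2 * y.1.2).
have lin2 := @is_derive_linear (fun y : R3 => y.2).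
have -> : 'i%C * (eta.1 * v.1.1 + eta.2 * v.1.2)%:C + r * v.2%:C =
 ('i%C * (eta.1 * v.1.1 + eta.2 * v.1.2)%:C +
    0 * (eta.1 * x.1.1 + eta.2 * x.1.2)%:C)
  + (r * v.2%:C + 0 * x.2%:C).
  by rewrite !mul0r !addr0.
apply: is_cderiveD; apply: is_cderiveM; try exact: is_cderive_cst;
  apply: is_cderive_real.
  by apply: lin1 => h [[? ?] ?] [[? ?] ?] /=; rewrite /GRing.scale /=; ring.
by apply: lin2.
Qed.

Lemma cderive_affine_wave a b k x : is_cderive x (std_dir R k) (affine_wave a b)
  (affine_wave (a * zeta eta r k 0) (b * zeta eta r k 0 + a * e3 R k 0) x).
Proof.
have dz : 'i%C * (eta.1 * (std_dir R k).1.1 + eta.2 * (std_dir R k).1.2)%:C +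
    r * (std_dir R k).2%:C
    = zeta eta r k 0.
  by move: k; apply: ord3P; rewrite !col3E /std_dir /= ?inordK //=
    !(mulr0, mulr1, addr0, add0r).
have de : (std_dir R k).2%:C = e3 R k 0.
  by move: k {dz}; apply: ord3P; rewrite !col3E /std_dir /= ?inordK.
rewrite /affine_wave.
(* The value is brought to the literal output of the sum and product rules, the null terms being
   derivatives of constants. *)
have -> : (a * zeta eta r k 0 * x.2%:C + (b * zeta eta r k 0 +
    a * e3 R k 0)) * plane_exp eta r x
  = (a * x.2%:C + b) * (zeta eta r k 0 * plane_exp eta r x)
    + ((a * e3 R k 0 + 0 * x.2%:C) + 0) * plane_exp eta r x by ring.
apply: is_cderiveM.
  apply: is_cderiveD; last exact: is_cderive_cst.
  apply: is_cderiveM; first exact: is_cderive_cst.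
  by rewrite -de; apply: is_cderive_real;
    apply: (@is_derive_linear (fun y : R3 => y.2)).
by rewrite -dz; apply: is_cderive_cexp; exact: plane_phase_cderive.
Qed.

Lemma pderiv_affine_wave a b k : pderiv k (affine_wave a b) =
  affine_wave (a * zeta eta r k 0) (b * zeta eta r k 0 + a * e3 R k 0).
Proof. by apply/funext => x; apply: pderivE; exact: cderive_affine_wave. Qed.

Lemma ccontinuous_affine_wave a b : ccontinuous (affine_wave a b).
Proof.
have fst_c : continuous (fun x : R3 => x.1) by move=> x; exact: cvg_fst.
have snd_c : continuous (fun x : R3 => x.2) by move=> x; exact: cvg_snd.
have x11 : continuous (fun x : R3 => x.1.1).
  by move=> x; apply: (cvg_comp _ _ (fst_c x)); exact: cvg_fst.
have x12 : continuous (fun x : R3 => x.1.2).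
  by move=> x; apply: (cvg_comp _ _ (fst_c x)); exact: cvg_snd.
have L : continuous (fun x : R3 => eta.1 * x.1.1 + eta.2 * x.1.2).
  by move=> x; apply: cvgD; apply: cvgM; try exact: cvg_cst;
    [exact: x11|exact: x12].
apply: ccontinuousM.
  by apply: ccontinuousD; [apply: ccontinuousM; [|exact: ccontinuous_real]|];
    exact: ccontinuous_cst.
apply: ccontinuous_cexp; apply: ccontinuousD; apply: ccontinuousM;
  try exact: ccontinuous_cst; exact: ccontinuous_real.
Qed.

Lemma smooth_affine_wave a b : smooth (affine_wave a b).
Proof.
move=> s; have [a' [b' ->]] : exists a' b', foldr (@pderiv R) (affine_wave a b)
  s = affine_wave a' b'.
  elim: s => [|k s [a' [b' E]]] /=; first by exists a, b.
  by rewrite E pderiv_affine_wave; eexists; eexists; reflexivity.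
rewrite /=; have [cr ci] := ccontinuous_affine_wave a' b'; split=> // k x.
by have [[? _] [? _]] := cderive_affine_wave a' b' k x.
Qed.

Variables (lam mu : R).
Local Notation t := (tau eta).

Lemma component_affine_wave (a b : 'cV[C]_3) k :
  component (fun x : R3 => plane_exp eta r x *: (x.2%:C *: a + b)) k =
    affine_wave (a k 0) (b k 0).
Proof.
by apply/funext => x; rewrite /component /affine_wave !mxE mulrC
  [X in X + _]mulrC.
Qed.

Lemma affine_wave_sum n (a b : 'I_n -> C) x :
  \sum_i affine_wave (a i) (b i) x = affine_wave (\sum_i a i) (\sum_i b i) x.
Proof. by rewrite /affine_wave !mulr_suml -big_split /= mulr_suml. Qed.

(** On the pure exponential the operator acts as the symbol. Since [x_3 exp (r x_3)] is the
    derivative of [exp (r x_3)] in [r], the factor [x_3] adds the derivative of the symbol applied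
    to [a]. *)
Lemma lame_affine_wave (a b : 'cV[C]_3) x :
  lame lam mu (fun x : R3 => plane_exp eta r x *: (x.2%:C *: a + b)) x =
  plane_exp eta r x *: (x.2%:C *: (symbol lam mu eta r *m a) +
    (symbol lam mu eta r *m b +
       mxeval (mxderivn 1 (symbolX lam mu eta)) r *m a)).
Proof.
set v := fun x : R3 => _; set z := zeta eta r.
(* The divergence is again an affine wave, so its gradient follows from the same derivative
   formula. *)
have divE : divergence v = affine_wave (bdot z a) (bdot z b + a (inord 2) 0).
  apply/funext => y; rewrite /divergence.
  under eq_bigr => j _ do rewrite component_affine_wave pderiv_affine_wave.
  rewrite affine_wave_sum; congr (affine_wave _ _ _).
    by apply: eq_bigr => j _; rewrite mulrC.
  by rewrite big_split /= [X in _ + X]sum3 !col3E !mulr0 !add0r mulr1;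
    congr (_ + _);
    apply: eq_bigr => j _; rewrite mulrC.
apply/colP => k; rewrite lameE divE pderiv_affine_wave -/z.
have -> : \sum_j pderiv j (pderiv j (component v k)) x =
   affine_wave (bdot z z * a k 0) (bdot z z * b k 0 + 2 * r * a k 0) x.
  under eq_bigr => j _ do rewrite component_affine_wave !pderiv_affine_wave -/z.
  rewrite affine_wave_sum !sum3 /bdot !sum3 /e3 /z /zeta !col3E.
  by congr (affine_wave _ _ _); ring.
have zz : bdot z z = r ^+ 2 - t%:C ^+ 2
    by rewrite bdot_col3 -!expr2 sqr_ieta addrC.
have PE c : (symbol lam mu eta r *m c) k 0 =
    mu%:C * bdot z z * c k 0 + (lam + mu)%:C * (bdot z c * z k 0).
  rewrite mulmxDl -!scalemxAl mul1mx mulmx_rank1 -zz [LHS]mxE.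
  by rewrite [X in X + _]mxE [X in _ + X = _]mxE [X in _ + _ * X = _]mxE.
have combE (x1 x2 x3 x4 : C) (u1 u2 u3 : 'cV[C]_3) :
    (x1 *: u1 + x2 *: (x3 *: u2 + x4 *: u3)) k 0 =
    x1 * u1 k 0 + x2 * (x3 * u2 k 0 + x4 * u3 k 0) by rewrite !mxE.
have combE' (s1 s2 : C) (u1 u2 u3 : 'cV[C]_3) :
    (s1 *: (s2 *: u1 + (u2 + u3))) k 0 =
      s1 * (s2 * u1 k 0 + (u2 k 0 + u3 k 0)) by rewrite !mxE.
rewrite combE' !PE symbolXE pencil_deriv1_at combE -/(e3 R) -/z.
by rewrite bdot_e3 /affine_wave -/z; ring.
Qed.
End PlaneWave.

(** * The Lame symbol and its chain solutions, for [lam + mu] nonzero and zero *)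

Theorem lemma3p3 (R : realType) (lam mu : R) (eta : R * R)
    (hmu : 0 < mu) (hlam : 0 < lam + 2 * mu) (heta : eta <> (0, 0)) :
  let P := symbol lam mu eta in
  let PX := symbolX lam mu eta in
  let t := tau eta in
  (forall (a : 'cV[R[i]]_3) (r : R[i]),
     let v := fun x => plane_exp eta r x *: a in
     (forall k, smooth (component v k)) /\
     (forall x, lame lam mu v x = plane_exp eta r x *: (P r *m a))) /\
  (forall r : R[i],
     \det (P r) = mu%:C ^+ 2 * (lam + 2 * mu)%:C * (r ^+ 2 - t%:C ^+ 2) ^+ 3) /\
  (lam + mu <> 0 ->
   forall r : R[i], r = t%:C \/ r = - t%:C ->
     let a0 := zeta eta r in
     let a1 := - ((cconst lam mu)%:C *: e3 R) in
     alg_mult PX r = 3%N /\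
     (forall a : 'cV[R[i]]_3, a \in colker (P r) <-> bdot a0 a = 0) /\
     \dim (colker (P r)) = 2%N /\
     P r *m a0 = 0 /\
     P r *m a1 + mxeval (mxderivn 1 PX) r *m a0 = 0 /\
     lame_space lam mu (weta lam mu eta r) /\
     partial_multiplicities PX r [:: 2%N; 1%N] /\
     (forall c, jordan_chain PX r c -> (size c <= 2)%N)) /\
  (lam + mu = 0 ->
     (forall r : R[i], P r = (mu%:C * (r ^+ 2 - t%:C ^+ 2)) *: 1%:M) /\
     (forall r : R[i], r = t%:C \/ r = - t%:C ->
        alg_mult PX r = 3%N /\ geom_mult PX r = 3%N /\ semisimple_root PX r)).
Proof.
move=> P PX t.
(* The pure plane wave is the affine wave whose coefficient of [x_3] is zero. *)
have waveE (a : 'cV[R[i]]_3) r : (fun x => plane_exp eta r x *: a) =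
    (fun x => plane_exp eta r x *: (x.2%:C *: 0 + a)).
  by apply/funext => x; rewrite scaler0 add0r.
have m0 : mu%:C != 0 by rewrite fmorph_eq0 gt_eqF.
have mb0 : mu%:C + (lam + mu)%:C != 0.
  by rewrite -rmorphD fmorph_eq0 gt_eqF // addrC -addrA -mulr2n
    -[mu *+ 2]mulr_natl.
have root (r : R[i]) : r = t%:C \/ r = - t%:C -> r ^+ 2 = t%:C ^+ 2 /\ r != 0.
  have t0 : t%:C != 0 by rewrite fmorph_eq0 tau_neq0.
  by case=> ->; rewrite ?sqrrN ?oppr_eq0.
split.
  move=> a r v; split=> [k|x].
    rewrite /v waveE component_affine_wave; exact: smooth_affine_wave.
  by rewrite /v waveE lame_affine_wave !mulmx0 scaler0 add0r addr0.
split; first exact: det_symbol.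
split=> [lm0 r /root[rt r0]|lm0].
  move=> a0 a1.
  have b0 : (lam + mu)%:C != 0 by rewrite fmorph_eq0; exact/eqP.
  (* With [m = mu] and [b = lam + mu], the factor [(2 m + b) / b] of the pencil chain is
     [cconst]. *)
  have cE : (cconst lam mu)%:C = (2 * mu%:C + (lam + mu)%:C) / (lam + mu)%:C.
    rewrite -[2]/(2%:R) -(rmorph_nat (real_complex R)) -rmorphM -rmorphD
      -fmorphV -rmorphM.
    by congr _%:C; rewrite /cconst; congr (_ / _); ring.
  have ieta := sqr_ieta eta.
  have PE : P r = mxeval PX r by rewrite mxeval_symbolX.
  have memP a : (a \in colker (P r)) = (bdot a0 a == 0).
    by rewrite PE; exact: mem_colker_pencil.
  have Pa0 : P r *m a0 = 0.
    apply/colkerP; rewrite memP bdot_col3 -!expr2 ieta rt.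
    by rewrite addNr.
  have Pa1 : P r *m a1 + mxeval (mxderivn 1 PX) r *m a0 = 0.
    by rewrite PE /a1 cE; exact: pencil_chain_rel.
  have wE : weta lam mu eta r =
      fun x => plane_exp eta r x *: (x.2%:C *: a0 + a1) by [].
  have sw k : smooth (component (weta lam mu eta r) k).
    rewrite wE component_affine_wave; exact: smooth_affine_wave.
  split; first exact: alg_mult_pencil.
  split; first by move=> a; rewrite memP; split=> [/eqP|/eqP].
  split; first by rewrite PE; exact: dim_colker_pencil.
  split=> //; split=> //; split.
    split; first exact: smooth_H1loc.
    apply: classical_weak_lame_solution => // x.
    (* The coefficient of [x_3] vanishes by the first chain relation, the remaining term by the
       second. *)
    by rewrite wE lame_affine_wave Pa0 Pa1 scaler0 addr0 scaler0.
  split; first exact: pencil_partial_multiplicities.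
  exact: (pencil_chain_size rt ieta).
have b0 : (lam + mu)%:C = 0 by rewrite lm0.
split=> r; first by rewrite /P /symbol b0 scale0r addr0.
move=> /root[rt r0]; split; last split.
- by apply: alg_mult_pencil => //; exact: sqr_ieta.
- exact: geom_mult_scalar_pencil.
- exact: semisimple_scalar_pencil.
Qed.
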